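(* Let $\Lambda\subseteq\mathbb Z$. If $\Lambda$ is not a $UC$-set (set of uniform convergence), then $U_\Lambda$ contains $c_0$.
   Context: $\mathbb T=\mathbb R/2\pi\mathbb Z$ is the circle group, with Haar measure $dt/2\pi$, and $e_n(t)=e^{int}$ for $n\in\mathbb Z$; $\hat f(n)=\int_{\mathbb T} f\,\overline{e_n}\,dt/2\pi$. For $f\in\mathcal C(\mathbb T)$ (continuous complex functions), $S_k(f)=\sum_{j=-k}^k\hat f(j)e_j$. $U(\mathbb T)$ is the space of all $f\in\mathcal C(\mathbb T)$ such that $\|S_k(f)-f\|_\infty\to0$ as $k\to+\infty$; it is a Banach space for the norm $\|f\|_U=\sup_{k\ge1}\|S_k(f)\|_\infty$. For $\Lambda\subseteq\mathbb Z$, $U_\Lambda$ and $\mathcal C_\Lambda$ are the subspaces of those $f$ in $U(\mathbb T)$, respectively $\mathcal C(\mathbb T)$, with $\hat f(n)=0$ for all $n\notin\Lambda$. $\Lambda$ is a $UC$-set if $U_\Lambda=\mathcal C_\Lambda$ as linear spaces. A Banach space $X$ contains $c_0$ if it has a closed subspace isomorphic to $c_0$. *)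

(* Defs.v *)
From Stdlib Require Import Reals ZArith Lra Lia.
From Stdlib Require Import ProofIrrelevance FunctionalExtensionality.
From Coquelicot Require Import Coquelicot.

Open Scope R_scope.

(* A complex vector space of functions on [D], given by a membership predicate
   and a norm that is only required to behave on members.  It is turned into a
   Coquelicot [NormedModule] over [C] on the sigma type of its members. *)
Record fun_space (D : Type) := FunSpace {
  fs_mem : (D -> C) -> Prop;
  fs_norm : (D -> C) -> R;
  fs_mem0 : fs_mem (fun _ => RtoC 0);
  fs_memD : forall f g, fs_mem f -> fs_mem g ->
    fs_mem (fun t => Cplus (f t) (g t));
  fs_memZ : forall (c : C) f, fs_mem f -> fs_mem (fun t => Cmult c (f t));
  fs_normD : forall f g, fs_mem f -> fs_mem g ->
    fs_norm (fun t => Cplus (f t) (g t)) <= fs_norm f + fs_norm g;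
  fs_normZ : forall (c : C) f, fs_mem f ->
    fs_norm (fun t => Cmult c (f t)) <= Cmod c * fs_norm f;
  fs_norm_eq0 : forall f, fs_mem f -> fs_norm f = 0 -> forall t, f t = RtoC 0
}.

Arguments fs_mem {D} _ _.
Arguments fs_norm {D} _ _.
Arguments fs_mem0 {D} _.
Arguments fs_memD {D} _ _ _ _ _.
Arguments fs_memZ {D} _ _ _ _.
Arguments fs_normD {D} _ _ _ _ _.
Arguments fs_normZ {D} _ _ _ _.
Arguments fs_norm_eq0 {D} _ _ _ _ _.

Section FunSpaceNormedModule.
Context {D : Type} (E : fun_space D).

Definition fs_type : Type := {f : D -> C | fs_mem E f}.

Lemma fs_eq (x y : fs_type) :
  (forall t, proj1_sig x t = proj1_sig y t) -> x = y.
Proof.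
destruct x as [f hf], y as [g hg]; simpl; intros H.
assert (e : f = g) by (apply functional_extensionality; exact H).
subst g; f_equal; apply proof_irrelevance.
Qed.

Definition fs_plus (x y : fs_type) : fs_type :=
  exist _ (fun t => Cplus (proj1_sig x t) (proj1_sig y t))
    (fs_memD E _ _ (proj2_sig x) (proj2_sig y)).

Definition fs_scal (c : C) (x : fs_type) : fs_type :=
  exist _ (fun t => Cmult c (proj1_sig x t)) (fs_memZ E c _ (proj2_sig x)).

Definition fs_zero : fs_type := exist _ (fun _ => RtoC 0) (fs_mem0 E).

Definition fs_opp (x : fs_type) : fs_type := fs_scal (Copp (RtoC 1)) x.

Definition fs_nrm (x : fs_type) : R := fs_norm E (proj1_sig x).

Definition fs_AbelianMonoid_mixin : AbelianMonoid.mixin_of fs_type.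
Proof.
apply (AbelianMonoid.Mixin fs_type fs_plus fs_zero); intros;
  apply fs_eq; intros t; simpl; ring.
Defined.

Definition fs_AbelianMonoid :=
  AbelianMonoid.Pack fs_type fs_AbelianMonoid_mixin fs_type.

Definition fs_AbelianGroup_mixin : AbelianGroup.mixin_of fs_AbelianMonoid.
Proof.
apply (AbelianGroup.Mixin fs_AbelianMonoid fs_opp).
intros x; apply fs_eq; intros t; simpl; ring.
Defined.

Definition fs_AbelianGroup :=
  AbelianGroup.Pack fs_type
    (AbelianGroup.Class _ fs_AbelianMonoid_mixin fs_AbelianGroup_mixin) fs_type.

Definition fs_ModuleSpace_mixin : ModuleSpace.mixin_of C_Ring fs_AbelianGroup.
Proof.
apply (ModuleSpace.Mixin C_Ring fs_AbelianGroup fs_scal); intros;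
  apply fs_eq; intros t; unfold mult, one, plus; simpl; ring.
Defined.

Definition fs_ModuleSpace_class : ModuleSpace.class_of C_Ring fs_type :=
  ModuleSpace.Class C_Ring fs_type _ fs_ModuleSpace_mixin.

Lemma fs_nrm_plus x y : fs_nrm (fs_plus x y) <= fs_nrm x + fs_nrm y.
Proof. apply fs_normD; apply proj2_sig. Qed.

Lemma fs_nrm_scal c x : fs_nrm (fs_scal c x) <= Cmod c * fs_nrm x.
Proof. apply fs_normZ; apply proj2_sig. Qed.

Lemma fs_nrm_eq0 x : fs_nrm x = 0 -> x = fs_zero.
Proof.
intros H; apply fs_eq; intros t; simpl.
exact (fs_norm_eq0 E _ (proj2_sig x) H t).
Qed.

Definition fs_ball (x : fs_type) (e : R) (y : fs_type) : Prop :=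
  fs_nrm (fs_plus y (fs_opp x)) < e.

Lemma fs_nrm_zero : fs_nrm fs_zero = 0.
Proof.
apply Rle_antisym.
- replace fs_zero with (fs_scal (RtoC 0) fs_zero)
    by (apply fs_eq; intros t; simpl; ring).
  eapply Rle_trans; [apply fs_nrm_scal|].
  rewrite Cmod_0; lra.
- assert (H := fs_nrm_plus fs_zero fs_zero).
  replace (fs_plus fs_zero fs_zero) with fs_zero in H
    by (apply fs_eq; intros t; simpl; ring).
  lra.
Qed.

Lemma fs_ball_center x (e : posreal) : fs_ball x e x.
Proof.
unfold fs_ball.
replace (fs_plus x (fs_opp x)) with fs_zero
  by (apply fs_eq; intros t; simpl; ring).
rewrite fs_nrm_zero; apply cond_pos.
Qed.

Lemma fs_ball_sym x y e : fs_ball x e y -> fs_ball y e x.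
Proof.
unfold fs_ball; intros H.
replace (fs_plus x (fs_opp y))
  with (fs_scal (Copp (RtoC 1)) (fs_plus y (fs_opp x)))
  by (apply fs_eq; intros t; simpl; ring).
eapply Rle_lt_trans; [apply fs_nrm_scal|].
rewrite Cmod_opp, Cmod_1; lra.
Qed.

Lemma fs_ball_triangle x y z e1 e2 :
  fs_ball x e1 y -> fs_ball y e2 z -> fs_ball x (e1 + e2) z.
Proof.
unfold fs_ball; intros H1 H2.
replace (fs_plus z (fs_opp x))
  with (fs_plus (fs_plus y (fs_opp x)) (fs_plus z (fs_opp y)))
  by (apply fs_eq; intros t; simpl; ring).
eapply Rle_lt_trans; [apply fs_nrm_plus|]; lra.
Qed.

Definition fs_UniformSpace_mixin : UniformSpace.mixin_of fs_type :=
  UniformSpace.Mixin fs_type fs_zero fs_ball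
    fs_ball_center fs_ball_sym fs_ball_triangle.

Definition fs_NormedModuleAux_class :
    NormedModuleAux.class_of C_AbsRing fs_type :=
  NormedModuleAux.Class C_AbsRing fs_type
    fs_ModuleSpace_class fs_UniformSpace_mixin.

Definition fs_NormedModule_mixin :
  NormedModule.mixin_of C_AbsRing
    (NormedModuleAux.Pack C_AbsRing fs_type fs_NormedModuleAux_class fs_type).
Proof.
apply (NormedModule.Mixin C_AbsRing
  (NormedModuleAux.Pack C_AbsRing fs_type fs_NormedModuleAux_class fs_type)
  fs_nrm 1).
- exact fs_nrm_plus.
- exact fs_nrm_scal.
- intros x y e H; exact H.
- intros x y e H; rewrite Rmult_1_l; exact H.
- exact fs_nrm_eq0.
Defined.

Definition fs_NormedModule : NormedModule C_AbsRing :=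
  NormedModule.Pack C_AbsRing fs_type
    (NormedModule.Class C_AbsRing fs_type _ fs_NormedModule_mixin) fs_type.

End FunSpaceNormedModule.

(* Meaningful for bounded [f] only: [real] sends [p_infty] to [0].  Below it is
   only applied to bounded functions (see [null_seq_bounded],
   [partial_sum_bounded] and [error_bounded]). *)
Definition sup_norm {D : Type} (f : D -> C) : R :=
  real (Lub_Rbar (fun x => exists t, x = Cmod (f t))).

Lemma real_lub (A : R -> Prop) (M x0 : R) :
  A x0 -> (forall x, A x -> x <= M) ->
  (forall x, A x -> x <= real (Lub_Rbar A)) /\ real (Lub_Rbar A) <= M.
Proof.
intros H0 HM.
destruct (Lub_Rbar_correct A) as [Hub Hl].
assert (H1 : Rbar_le (Lub_Rbar A) (Finite M))
  by (apply Hl; intros x hx; apply HM, hx).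
assert (H2 := Hub x0 H0).
destruct (Lub_Rbar A) as [r| |]; simpl in *; try contradiction.
split; [|exact H1]; intros x hx; exact (Hub x hx).
Qed.

Definition bounded_fun {D : Type} (f : D -> C) : Prop :=
  exists M, forall t, Cmod (f t) <= M.

Lemma sup_norm_ub {D : Type} (f : D -> C) t :
  bounded_fun f -> Cmod (f t) <= sup_norm f.
Proof.
intros [M HM].
destruct (real_lub (fun x => exists t, x = Cmod (f t)) M (Cmod (f t)))
  as [H _]; [now exists t| |].
- intros x [s ->]; apply HM.
- apply H; now exists t.
Qed.

Lemma sup_norm_le {D : Type} (t0 : D) (f : D -> C) M :
  (forall t, Cmod (f t) <= M) -> sup_norm f <= M.
Proof.
intros HM.
destruct (real_lub (fun x => exists t, x = Cmod (f t)) M (Cmod (f t0)))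
  as [_ H]; [now exists t0| |exact H].
intros x [s ->]; apply HM.
Qed.

Lemma bounded_plus {D : Type} (f g : D -> C) : bounded_fun f -> bounded_fun g ->
  bounded_fun (fun t => Cplus (f t) (g t)).
Proof.
intros [M HM] [N HN]; exists (M + N); intros t.
eapply Rle_trans; [apply Cmod_triangle|].
specialize (HM t); specialize (HN t); lra.
Qed.

Lemma bounded_scal {D : Type} (c : C) (f : D -> C) : bounded_fun f ->
  bounded_fun (fun t => Cmult c (f t)).
Proof.
intros [M HM]; exists (Cmod c * M); intros t; rewrite Cmod_mult.
apply Rmult_le_compat_l; [apply Cmod_ge_0|apply HM].
Qed.

Lemma sup_norm_plus {D : Type} (t0 : D) (f g : D -> C) :
  bounded_fun f -> bounded_fun g ->
  sup_norm (fun t => Cplus (f t) (g t)) <= sup_norm f + sup_norm g.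
Proof.
intros hf hg; apply (sup_norm_le t0); intros t.
eapply Rle_trans; [apply Cmod_triangle|].
apply Rplus_le_compat; now apply sup_norm_ub.
Qed.

Lemma sup_norm_scal {D : Type} (t0 : D) (c : C) (f : D -> C) : bounded_fun f ->
  sup_norm (fun t => Cmult c (f t)) <= Cmod c * sup_norm f.
Proof.
intros hf; apply (sup_norm_le t0); intros t; rewrite Cmod_mult.
apply Rmult_le_compat_l; [apply Cmod_ge_0|now apply sup_norm_ub].
Qed.

Lemma sup_norm_ge0 {D : Type} (t0 : D) (f : D -> C) : bounded_fun f ->
  0 <= sup_norm f.
Proof.
intros hf; apply Rle_trans with (Cmod (f t0)); [apply Cmod_ge_0|].
now apply sup_norm_ub.
Qed.

Lemma sup_norm_ext {D : Type} (f g : D -> C) :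
  (forall t, f t = g t) -> sup_norm f = sup_norm g.
Proof.
intros H; unfold sup_norm; f_equal; apply Lub_Rbar_eqset; intros x.
split; intros [t ->]; exists t; now rewrite H.
Qed.

Definition null_seq (a : nat -> C) : Prop :=
  filterlim a eventually (locally (RtoC 0)).

Lemma null_seq_bounded a : null_seq a -> bounded_fun a.
Proof.
intros H.
destruct (filterlim_bounded (K := C_AbsRing) (V := C_NormedModule) a) as [M HM].
- now exists (RtoC 0).
- exists M; exact HM.
Qed.

Lemma null_seq_0 : null_seq (fun _ => RtoC 0).
Proof. apply filterlim_const. Qed.

Lemma null_seq_plus a b : null_seq a -> null_seq b ->
  null_seq (fun n => Cplus (a n) (b n)).
Proof.
intros ha hb; unfold null_seq.
replace (RtoC 0) with (Cplus (RtoC 0) (RtoC 0)) by ring.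
exact (filterlim_comp_2 _ _ _ ha hb
  (filterlim_plus (K := C_AbsRing) (V := C_NormedModule) (RtoC 0) (RtoC 0))).
Qed.

Lemma null_seq_scal c a : null_seq a -> null_seq (fun n => Cmult c (a n)).
Proof.
intros ha; unfold null_seq.
replace (RtoC 0) with (Cmult c (RtoC 0)) by ring.
exact (filterlim_comp _ _ _ _ _ _ _ _ ha
  (filterlim_scal_r (K := C_AbsRing) (V := C_NormedModule) c (RtoC 0))).
Qed.

Definition c0_space : fun_space nat.
Proof.
refine (FunSpace nat null_seq sup_norm null_seq_0 null_seq_plus null_seq_scal
  _ _ _).
- intros f g hf hg; apply (sup_norm_plus O); now apply null_seq_bounded.
- intros c f hf; apply (sup_norm_scal O); now apply null_seq_bounded.
- intros f hf h0 t; apply Cmod_eq_0, Rle_antisym; [|apply Cmod_ge_0].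
  rewrite <- h0; apply sup_norm_ub; now apply null_seq_bounded.
Defined.

Definition c0 : NormedModule C_AbsRing := fs_NormedModule c0_space.

Definition is_subspace {X : NormedModule C_AbsRing} (Y : X -> Prop) : Prop :=
  Y zero /\ (forall x y, Y x -> Y y -> Y (plus x y)) /\
  (forall (c : C) x, Y x -> Y (scal c x)).

(* [is_linear] includes boundedness of [T]; [S], defined on all of [X] for
   convenience, matters only on [Y], where it is the bounded inverse of [T]. *)
Definition isomorphic_onto {E X : NormedModule C_AbsRing} (Y : X -> Prop) :
    Prop :=
  exists (T : E -> X) (S : X -> E),
    is_linear T /\
    (forall a, Y (T a)) /\
    (forall a, S (T a) = a) /\
    (forall y, Y y -> T (S y) = y) /\
    (exists M : R, forall y, Y y -> norm (S y) <= M * norm y).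

Definition contains_c0 (X : NormedModule C_AbsRing) : Prop :=
  exists Y : X -> Prop,
    is_subspace Y /\ closed Y /\ isomorphic_onto (E := c0) Y.

(* Functions on the circle are 2pi-periodic functions on R. *)
Definition continuous_circle (f : R -> C) : Prop :=
  (forall t, f (t + 2 * PI) = f t) /\ (forall t, continuous f t).

Definition e_ (n : Z) (t : R) : C := (cos (IZR n * t), sin (IZR n * t)).

Definition CInt (f : R -> C) (a b : R) : C :=
  (RInt (fun t => Re (f t)) a b, RInt (fun t => Im (f t)) a b).

Definition fourier_coef (f : R -> C) (n : Z) : C :=
  Cdiv (CInt (fun t => Cmult (f t) (Cconj (e_ n t))) 0 (2 * PI))
       (RtoC (2 * PI)).

(* The frequency is [j = i - k], for [i] from [0] to [2k]. *)
Definition partial_sum (k : nat) (f : R -> C) (t : R) : C :=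
  sum_n (fun i => let j := (Z.of_nat i - Z.of_nat k)%Z in
                  Cmult (fourier_coef f j) (e_ j t)) (2 * k).

Definition in_U (f : R -> C) : Prop :=
  continuous_circle f /\
  is_lim_seq (fun k => sup_norm (fun t => Cminus (partial_sum k f t) (f t))) 0.

Definition spectrum_in (Lambda : Z -> Prop) (f : R -> C) : Prop :=
  forall n : Z, ~ Lambda n -> fourier_coef f n = RtoC 0.

Definition in_C_Lambda (Lambda : Z -> Prop) (f : R -> C) : Prop :=
  continuous_circle f /\ spectrum_in Lambda f.

Definition in_U_Lambda (Lambda : Z -> Prop) (f : R -> C) : Prop :=
  in_U f /\ spectrum_in Lambda f.

Definition UC_set (Lambda : Z -> Prop) : Prop :=
  forall f : R -> C, in_U_Lambda Lambda f <-> in_C_Lambda Lambda f.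

(* The supremum is finite on [in_U], see [sup_partial_bounded]. *)
Definition U_norm (f : R -> C) : R :=
  real (Lub_Rbar (fun x => exists k : nat,
    (1 <= k)%nat /\ x = sup_norm (partial_sum k f))).

Lemma continuous_Re (f : R -> C) t :
  continuous f t -> continuous (fun t => Re (f t)) t.
Proof. intros H; exact (continuous_comp f fst t H (continuous_fst _ _)). Qed.

Lemma continuous_Im (f : R -> C) t :
  continuous f t -> continuous (fun t => Im (f t)) t.
Proof. intros H; exact (continuous_comp f snd t H (continuous_snd _ _)). Qed.

Lemma continuous_Cpair (f : R -> C) t :
  continuous (fun t => Re (f t)) t -> continuous (fun t => Im (f t)) t ->
  continuous f t.
Proof.
intros H1 H2 P [eps HP].
specialize (H1 (ball (Re (f t)) eps) (locally_ball _ _)).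
specialize (H2 (ball (Im (f t)) eps) (locally_ball _ _)).
unfold filtermap in *.
generalize (filter_and _ _ H1 H2); apply filter_imp.
intros s [h1 h2]; apply HP; split; assumption.
Qed.

Lemma continuous_Cmul (f g : R -> C) t : continuous f t -> continuous g t ->
  continuous (fun t => Cmult (f t) (g t)) t.
Proof.
intros hf hg; apply continuous_Cpair.
- apply continuous_ext with
    (fun t => Re (f t) * Re (g t) - Im (f t) * Im (g t));
    [reflexivity|].
  apply (continuous_minus (V := R_NormedModule));
    apply (continuous_mult (K := R_AbsRing));
    auto using continuous_Re, continuous_Im.
- apply continuous_ext with
    (fun t => Re (f t) * Im (g t) + Im (f t) * Re (g t));
    [reflexivity|].
  apply (continuous_plus (V := R_NormedModule));
    apply (continuous_mult (K := R_AbsRing));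
    auto using continuous_Re, continuous_Im.
Qed.

Lemma continuous_Cadd (f g : R -> C) t : continuous f t -> continuous g t ->
  continuous (fun t => Cplus (f t) (g t)) t.
Proof.
intros hf hg; apply continuous_Cpair;
  apply (continuous_plus (V := R_NormedModule));
    auto using continuous_Re, continuous_Im.
Qed.

Lemma continuous_e_conj n t : continuous (fun t => Cconj (e_ n t)) t.
Proof.
apply continuous_Cpair; simpl.
- apply (ex_derive_continuous (V := R_NormedModule)); auto_derive; auto.
- apply (ex_derive_continuous (V := R_NormedModule)); auto_derive; auto.
Qed.

Lemma Cmod_e n t : Cmod (e_ n t) = 1.
Proof.
unfold Cmod, e_; simpl.
replace (_ + _) with 1; [apply sqrt_1|].
rewrite !Rmult_1_r; generalize (sin2_cos2 (IZR n * t)); unfold Rsqr; lra.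
Qed.

Lemma ex_RInt_cont (f : R -> R) a b :
  (forall t, continuous f t) -> ex_RInt f a b.
Proof.
intros H; apply (ex_RInt_continuous (V := R_CompleteNormedModule)); auto.
Qed.

Lemma CInt_plus f g a b :
  (forall t, continuous f t) -> (forall t, continuous g t) ->
  CInt (fun t => Cplus (f t) (g t)) a b = Cplus (CInt f a b) (CInt g a b).
Proof.
intros hf hg; unfold CInt, Cplus; simpl; f_equal;
  apply (RInt_plus (V := R_CompleteNormedModule)); apply ex_RInt_cont; intros;
  auto using continuous_Re, continuous_Im.
Qed.

Lemma CInt_scal c f a b :
  (forall t, continuous f t) ->
  CInt (fun t => Cmult c (f t)) a b = Cmult c (CInt f a b).
Proof.
intros hf.
assert (h1 : ex_RInt (fun t => Re (f t)) a b)
  by (apply ex_RInt_cont; intros; apply continuous_Re, hf).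
assert (h2 : ex_RInt (fun t => Im (f t)) a b)
  by (apply ex_RInt_cont; intros; apply continuous_Im, hf).
assert (hs1 := fun l => RInt_scal (V := R_CompleteNormedModule) _ a b l h1).
assert (hs2 := fun l => RInt_scal (V := R_CompleteNormedModule) _ a b l h2).
assert (hx1 := fun l => ex_RInt_scal (V := R_NormedModule) _ a b l h1).
assert (hx2 := fun l => ex_RInt_scal (V := R_NormedModule) _ a b l h2).
unfold CInt, Cmult; simpl; f_equal.
- rewrite (RInt_ext _ (fun t => minus (scal (fst c) (Re (f t)))
    (scal (snd c) (Im (f t))))) by reflexivity.
  rewrite (RInt_minus (V := R_CompleteNormedModule)) by auto.
  rewrite hs1, hs2; reflexivity.
- rewrite (RInt_ext _ (fun t => plus (scal (fst c) (Im (f t)))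
    (scal (snd c) (Re (f t))))) by reflexivity.
  rewrite (RInt_plus (V := R_CompleteNormedModule)) by auto.
  rewrite hs1, hs2; reflexivity.
Qed.

Lemma CInt_ext f g a b : (forall t, f t = g t) -> CInt f a b = CInt g a b.
Proof.
intros H; unfold CInt; f_equal; apply RInt_ext; intros; now rewrite H.
Qed.

Lemma fourier_coef_plus f g n :
  continuous_circle f -> continuous_circle g ->
  fourier_coef (fun t => Cplus (f t) (g t)) n =
  Cplus (fourier_coef f n) (fourier_coef g n).
Proof.
intros [_ hf] [_ hg]; unfold fourier_coef, Cdiv.
rewrite <- Cmult_plus_distr_r; f_equal.
rewrite <- CInt_plus.
- apply CInt_ext; intros t; ring.
- intros t; apply continuous_Cmul; [apply hf|apply continuous_e_conj].
- intros t; apply continuous_Cmul; [apply hg|apply continuous_e_conj].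
Qed.

Lemma fourier_coef_scal c f n :
  continuous_circle f ->
  fourier_coef (fun t => Cmult c (f t)) n = Cmult c (fourier_coef f n).
Proof.
intros [_ hf]; unfold fourier_coef, Cdiv.
rewrite Cmult_assoc; f_equal.
rewrite <- CInt_scal.
- apply CInt_ext; intros t; ring.
- intros t; apply continuous_Cmul; [apply hf|apply continuous_e_conj].
Qed.

Lemma continuous_circle_plus f g :
  continuous_circle f -> continuous_circle g ->
  continuous_circle (fun t => Cplus (f t) (g t)).
Proof.
intros [pf hf] [pg hg]; split; intros t.
- now rewrite pf, pg.
- apply continuous_Cadd; auto.
Qed.

Lemma continuous_circle_scal c f :
  continuous_circle f -> continuous_circle (fun t => Cmult c (f t)).
Proof.
intros [pf hf]; split; intros t.
- now rewrite pf.
- apply continuous_Cmul; [apply continuous_const|auto].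
Qed.

Lemma continuous_circle_0 : continuous_circle (fun _ => RtoC 0).
Proof. split; intros t; [reflexivity|apply continuous_const]. Qed.

Lemma periodic_nat f n t : (forall t, f (t + 2 * PI) = f t :> C) ->
  f (t + INR n * (2 * PI)) = f t.
Proof.
intros H; induction n as [|n IH].
- f_equal; simpl; ring.
- rewrite <- IH, <- (H (t + INR n * (2 * PI))); f_equal; rewrite S_INR; ring.
Qed.

Lemma periodic_Z f n t : (forall t, f (t + 2 * PI) = f t :> C) ->
  f (t + IZR n * (2 * PI)) = f t.
Proof.
intros H; destruct (Z_le_dec 0 n) as [h|h].
- rewrite <- (Z2Nat.id n) by lia; rewrite <- INR_IZR_INZ; now apply periodic_nat.
- rewrite <- (periodic_nat f (Z.to_nat (- n)) (t + IZR n * (2 * PI)) H).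
  f_equal; rewrite INR_IZR_INZ, Z2Nat.id, opp_IZR by lia; ring.
Qed.

Lemma continuous_circle_bounded f : continuous_circle f -> bounded_fun f.
Proof.
intros [pf hf].
assert (hpi := PI_RGT_0).
destruct (continuity_ab_maj (fun t => Cmod (f t)) 0 (2 * PI)) as [Mx [HM _]].
- lra.
- intros c _; apply continuity_pt_filterlim.
  exact (filterlim_comp _ _ _ f Cmod _ _ _ (hf c)
    (filterlim_norm (K := C_AbsRing) (V := C_NormedModule) (f c))).
- exists (Cmod (f Mx)); intros t.
  destruct (archimed (t / (2 * PI))) as [h1 h2].
  rewrite <- (periodic_Z f (1 - up (t / (2 * PI))) t pf).
  apply (HM _); rewrite minus_IZR.
  set (u := IZR (up (t / (2 * PI)))) in *.
  assert (e : t = t / (2 * PI) * (2 * PI)) by (field; lra).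
  split; nra.
Qed.

Lemma sum_n_Cmult (c : C) (u : nat -> C) n :
  Cmult c (sum_n u n) = sum_n (fun i => Cmult c (u i)) n.
Proof.
induction n as [|n IH]; [now rewrite !sum_O|].
rewrite !sum_Sn, <- IH; unfold plus; simpl; ring.
Qed.

Lemma partial_sum_plus k f g t :
  continuous_circle f -> continuous_circle g ->
  partial_sum k (fun t => Cplus (f t) (g t)) t =
  Cplus (partial_sum k f t) (partial_sum k g t).
Proof.
intros hf hg; unfold partial_sum.
change Cplus with (@plus C_AbelianMonoid) at 2.
rewrite <- sum_n_plus; apply sum_n_ext; intros i; cbv zeta.
rewrite fourier_coef_plus by assumption; unfold plus; simpl; ring.
Qed.

Lemma partial_sum_scal k c f t :
  continuous_circle f ->
  partial_sum k (fun t => Cmult c (f t)) t = Cmult c (partial_sum k f t).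
Proof.
intros hf; unfold partial_sum; rewrite sum_n_Cmult.
apply sum_n_ext; intros i; cbv zeta.
rewrite fourier_coef_scal by assumption; simpl; ring.
Qed.

Lemma partial_sum_bounded k f : bounded_fun (partial_sum k f).
Proof.
unfold partial_sum; generalize (2 * k)%nat; intros n.
assert (H : forall j, bounded_fun (fun t => Cmult (fourier_coef f j) (e_ j t))).
{ intros j; apply bounded_scal; exists 1; intros t; rewrite Cmod_e; lra. }
induction n as [|n [M HM]].
- destruct (H (Z.of_nat 0 - Z.of_nat k)%Z) as [M HM]; exists M; intros t.
  rewrite sum_O; apply HM.
- destruct (H (Z.of_nat (S n) - Z.of_nat k)%Z) as [N HN]; exists (M + N).
  intros t; rewrite sum_Sn; eapply Rle_trans; [apply Cmod_triangle|].
  apply Rplus_le_compat; [apply HM|apply HN].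
Qed.

Lemma error_bounded k f : continuous_circle f ->
  bounded_fun (fun t => Cminus (partial_sum k f t) (f t)).
Proof.
intros hf.
destruct (continuous_circle_bounded f hf) as [M HM].
destruct (partial_sum_bounded k f) as [N HN].
exists (N + M); intros t; unfold Cminus.
eapply Rle_trans; [apply Cmod_triangle|].
rewrite Cmod_opp; apply Rplus_le_compat; [apply HN|apply HM].
Qed.

Lemma is_lim_seq_squeeze0 (u v : nat -> R) :
  (forall n, 0 <= u n <= v n) -> is_lim_seq v 0 -> is_lim_seq u 0.
Proof.
intros H hv.
apply (is_lim_seq_le_le (fun _ => 0) u v); auto; apply is_lim_seq_const.
Qed.

Lemma in_U_plus f g : in_U f -> in_U g -> in_U (fun t => Cplus (f t) (g t)).
Proof.
intros [hf lf] [hg lg]; split; [now apply continuous_circle_plus|].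
assert (l := is_lim_seq_plus' _ _ _ _ lf lg); rewrite Rplus_0_l in l.
revert l; apply is_lim_seq_squeeze0; intros k; split.
- apply (sup_norm_ge0 0), error_bounded; now apply continuous_circle_plus.
- eapply Rle_trans; [|apply (sup_norm_plus 0); now apply error_bounded].
  apply Req_le, sup_norm_ext; intros t.
  rewrite partial_sum_plus by assumption; ring.
Qed.

Lemma in_U_scal c f : in_U f -> in_U (fun t => Cmult c (f t)).
Proof.
intros [hf lf]; split; [now apply continuous_circle_scal|].
assert (l := is_lim_seq_scal_l _ (Cmod c) _ lf).
replace (Rbar_mult (Cmod c) 0) with (Finite 0) in l
  by (simpl; now rewrite Rmult_0_r).
revert l; apply is_lim_seq_squeeze0; intros k; split.
- apply (sup_norm_ge0 0), error_bounded; now apply continuous_circle_scal.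
- eapply Rle_trans; [|apply (sup_norm_scal 0); now apply error_bounded].
  apply Req_le, sup_norm_ext; intros t.
  rewrite partial_sum_scal by assumption; ring.
Qed.

Lemma fourier_coef_0 n : fourier_coef (fun _ => RtoC 0) n = RtoC 0.
Proof.
transitivity (fourier_coef (fun _ => Cmult (RtoC 0) (RtoC 0)) n).
- f_equal; apply functional_extensionality; intros; ring.
- rewrite fourier_coef_scal by exact continuous_circle_0; ring.
Qed.

Lemma in_U_0 : in_U (fun _ => RtoC 0).
Proof.
split; [exact continuous_circle_0|].
apply is_lim_seq_ext with (fun _ => 0); [|apply is_lim_seq_const].
intros k.
assert (H : forall t : R,
  Cminus (partial_sum k (fun _ => RtoC 0) t) (RtoC 0) = RtoC 0).
{ intros t.
  assert (E : partial_sum k (fun _ => RtoC 0) t = RtoC 0).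
  { transitivity (partial_sum k (fun _ => Cmult (RtoC 0) (RtoC 0)) t).
    - f_equal; apply functional_extensionality; intros; ring.
    - rewrite partial_sum_scal by exact continuous_circle_0; ring. }
  rewrite E; ring. }
apply Rle_antisym.
- apply (sup_norm_ge0 0), error_bounded, continuous_circle_0.
- apply (sup_norm_le 0); intros t; rewrite H, Cmod_0; lra.
Qed.

Lemma sup_partial_bounded f : in_U f ->
  exists M, forall k, sup_norm (partial_sum k f) <= M.
Proof.
intros [hf lf].
destruct (filterlim_bounded (K := R_AbsRing) (V := R_NormedModule)
  (fun k => sup_norm (fun t => Cminus (partial_sum k f t) (f t)))) as [M HM].
- exists 0; exact lf.
- exists (M + sup_norm f); intros k.
  assert (hb := continuous_circle_bounded f hf).
  assert (he := error_bounded k f hf).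
  eapply Rle_trans; [|apply Rplus_le_compat_r].
  + rewrite (sup_norm_ext (partial_sum k f)
      (fun t => Cplus (Cminus (partial_sum k f t) (f t)) (f t)))
      by (intros t; ring).
    apply (sup_norm_plus 0); assumption.
  + eapply Rle_trans; [apply Rle_abs|apply (HM k)].
Qed.

Lemma U_norm_ub f k : in_U f -> (1 <= k)%nat ->
  sup_norm (partial_sum k f) <= U_norm f.
Proof.
intros hf hk; destruct (sup_partial_bounded f hf) as [M HM].
apply (real_lub (fun x => exists k : nat,
    (1 <= k)%nat /\ x = sup_norm (partial_sum k f)) M
    (sup_norm (partial_sum k f))).
- now exists k.
- intros x [j [_ ->]]; apply HM.
- now exists k.
Qed.

Lemma U_norm_le f M :
  (forall k, (1 <= k)%nat -> sup_norm (partial_sum k f) <= M) -> U_norm f <= M.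
Proof.
intros HM.
apply (real_lub (fun x => exists k : nat,
    (1 <= k)%nat /\ x = sup_norm (partial_sum k f)) M
    (sup_norm (partial_sum 1 f))).
- exists 1%nat; split; [lia|reflexivity].
- intros x [j [hj ->]]; now apply HM.
Qed.

Definition U_space (Lambda : Z -> Prop) : fun_space R.
Proof.
refine (FunSpace R (in_U_Lambda Lambda) U_norm _ _ _ _ _ _).
- split; [exact in_U_0|intros n _; apply fourier_coef_0].
- intros f g [hf sf] [hg sg]; split; [now apply in_U_plus|].
  intros n hn; rewrite fourier_coef_plus by (apply hf || apply hg).
  rewrite sf, sg by assumption; ring.
- intros c f [hf sf]; split; [now apply in_U_scal|].
  intros n hn; rewrite fourier_coef_scal by apply hf.
  rewrite sf by assumption; ring.
- intros f g [hf _] [hg _]; apply U_norm_le; intros k hk.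
  rewrite (sup_norm_ext _ _ (fun t =>
    partial_sum_plus k f g t (proj1 hf) (proj1 hg))).
  eapply Rle_trans; [apply (sup_norm_plus 0); apply partial_sum_bounded|].
  apply Rplus_le_compat; now apply U_norm_ub.
- intros c f [hf _]; apply U_norm_le; intros k hk.
  rewrite (sup_norm_ext _ _ (fun t => partial_sum_scal k c f t (proj1 hf))).
  eapply Rle_trans; [apply (sup_norm_scal 0); apply partial_sum_bounded|].
  apply Rmult_le_compat_l; [apply Cmod_ge_0|now apply U_norm_ub].
- intros f [hf _] h0 t.
  assert (hS : forall k, (1 <= k)%nat -> partial_sum k f t = RtoC 0).
  { intros k hk; apply Cmod_eq_0, Rle_antisym; [|apply Cmod_ge_0].
    rewrite <- h0; eapply Rle_trans; [|now apply U_norm_ub, hk].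
    apply sup_norm_ub, partial_sum_bounded. }
  apply Cmod_eq_0, Rle_antisym; [|apply Cmod_ge_0].
  destruct hf as [hc lf].
  apply (is_lim_seq_incr_1) in lf.
  refine (is_lim_seq_le (fun _ => Cmod (f t)) _ (Cmod (f t)) 0 _
    (is_lim_seq_const _) lf).
  intros k; eapply Rle_trans; [|apply sup_norm_ub with (t := t); now apply error_bounded].
  cbv beta; rewrite hS by lia.
  replace (Cminus (RtoC 0) (f t)) with (Copp (f t)) by ring.
  rewrite Cmod_opp; lra.
Defined.

Definition U_Lambda (Lambda : Z -> Prop) : NormedModule C_AbsRing :=
  fs_NormedModule (U_space Lambda).

(* Main.v *)
Require Import Defs.
From Stdlib Require Import Reals ZArith Lra Lia.
From Stdlib Require Import Classical ClassicalEpsilon FunctionalExtensionality.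
From Coquelicot Require Import Coquelicot.

(** Gliding hump.  Let [f] be a continuous function with spectrum in [Lambda]
    whose partial sums do not converge uniformly.  The difference of two
    polynomial approximations of [f] is uniformly small but, if the second one
    is taken late enough, has a partial sum that is not small; removing its low
    frequencies costs little.  Normalised in [U], this gives polynomials [h n]
    with spectra in [Lambda] and in successive bands [N n < |j| <= N (S n)],
    with sup norm at most [2^-n] and [U]-norm comparable to 1.  A partial sum of
    [sum a_n h_n] is an absolutely small sum plus a single term
    [a_m S_k(h_m)], so [a |-> sum a_n h_n] embeds [c0] into [U_Lambda]. *)

Open Scope R_scope.

(** * Fourier coefficients and partial sums *)

(** The obstacle is that the available sup-norm bound for [S_k] grows with [k]. Each accuracy must
    therefore be chosen after the index it has to resist: that of the first polynomial after [N],
    that of the second one after the late index [k] at which [f] misbehaves. The partial sums of [f]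
    cannot serve as approximations, since they do not converge uniformly. Convolution with a
    positive kernel replaces them; it only multiplies Fourier coefficients, so the spectrum stays in
    [Lambda]. The lower bound of the embedding comes from a difference of two partial sums of
    [sum a_n h_n], which isolates one cut block. Combined with the completeness of [c0], it also
    makes the image closed. *)

Lemma RtoC_neq0 (x : R) : x <> 0 -> RtoC x <> RtoC 0.
Proof. intros h H; apply h; injection H; auto. Qed.

Lemma Cmod_le_Re_Im (z : C) : Cmod z <= Rabs (Re z) + Rabs (Im z).
Proof.
rewrite <- (Rabs_pos_eq (Rabs (Re z) + Rabs (Im z)));
  [|generalize (Rabs_pos (Re z)) (Rabs_pos (Im z)); lra].
unfold Cmod; rewrite <- sqrt_Rsqr_abs; apply sqrt_le_1_alt.
unfold Rsqr, Re, Im; rewrite <- (pow2_abs (fst z)), <- (pow2_abs (snd z)).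
generalize (Rabs_pos (fst z)) (Rabs_pos (snd z)); nra.
Qed.

Lemma abs_Im_le (z : C) : Rabs (Im z) <= Cmod z.
Proof. eapply Rle_trans; [|apply Rmax_Cmod]; apply Rmax_r. Qed.

(** [CInt] is defined by components, so the bounds for the real and imaginary parts are added. This
    is the origin of the factors 2 in the later estimates. *)
Lemma CInt_bound f (g : R -> R) a b :
  a <= b -> (forall t, continuous f t) -> (forall t, continuous g t) ->
  (forall t, Cmod (f t) <= g t) -> Cmod (CInt f a b) <= 2 * RInt g a b.
Proof.
intros hab hf hg H.
assert (K : forall h : R -> R, (forall t, continuous h t) ->
  (forall t, Rabs (h t) <= g t) -> Rabs (RInt h a b) <= RInt g a b).
{ intros h ch Hh.
  eapply Rle_trans; [apply abs_RInt_le; [exact hab|now apply ex_RInt_cont]|].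
  apply RInt_le; [exact hab| |now apply ex_RInt_cont|intros; apply Hh].
  apply ex_RInt_cont; intros t; apply continuous_comp; [apply ch|].
  apply continuous_Rabs. }
eapply Rle_trans; [apply Cmod_le_Re_Im|]; simpl.
assert (H1 := K (fun t => Re (f t)) (fun t => continuous_Re _ _ (hf t))
  (fun t => Rle_trans _ _ _ (re_le_Cmod _) (H t))).
assert (H2 := K (fun t => Im (f t)) (fun t => continuous_Im _ _ (hf t))
  (fun t => Rle_trans _ _ _ (abs_Im_le _) (H t))).
lra.
Qed.

Lemma two_PI_pos : 0 < 2 * PI.
Proof. generalize PI_RGT_0; lra. Qed.

Lemma fourier_coef_bound f n M :
  continuous_circle f -> (forall t, Cmod (f t) <= M) ->
  Cmod (fourier_coef f n) <= 2 * M.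
Proof.
intros [_ hf] H; unfold fourier_coef.
assert (hp := two_PI_pos).
rewrite Cmod_div by (apply RtoC_neq0; lra).
rewrite Cmod_R, Rabs_pos_eq by lra.
apply Rle_div_l; [lra|].
eapply Rle_trans; [apply (CInt_bound _ (fun _ => M));
  [lra| |intros; apply continuous_const|]|].
- intros t; apply continuous_Cmul; [apply hf|apply continuous_e_conj].
- intros t; rewrite Cmod_mult, Cmod_conj, Cmod_e, Rmult_1_r; apply H.
- rewrite RInt_const; unfold scal; simpl; unfold mult; simpl; lra.
Qed.

Lemma fourier_coef_minus f g n :
  continuous_circle f -> continuous_circle g ->
  fourier_coef (fun t => Cminus (f t) (g t)) n =
  Cminus (fourier_coef f n) (fourier_coef g n).
Proof.
intros hf hg.
replace (fun t => Cminus (f t) (g t))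
  with (fun t => Cplus (f t) (Cmult (Copp (RtoC 1)) (g t)))
  by (apply functional_extensionality; intros t; ring).
rewrite fourier_coef_plus, fourier_coef_scal; auto using continuous_circle_scal.
ring.
Qed.

Lemma continuous_circle_minus f g :
  continuous_circle f -> continuous_circle g ->
  continuous_circle (fun t => Cminus (f t) (g t)).
Proof.
intros hf hg.
replace (fun t => Cminus (f t) (g t))
  with (fun t => Cplus (f t) (Cmult (Copp (RtoC 1)) (g t)))
  by (apply functional_extensionality; intros t; ring).
auto using continuous_circle_plus, continuous_circle_scal.
Qed.

Lemma partial_sum_minus k f g t :
  continuous_circle f -> continuous_circle g ->
  partial_sum k (fun t => Cminus (f t) (g t)) t =
  Cminus (partial_sum k f t) (partial_sum k g t).
Proof.
intros hf hg.
replace (fun t => Cminus (f t) (g t))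
  with (fun t => Cplus (f t) (Cmult (Copp (RtoC 1)) (g t)))
  by (apply functional_extensionality; intros s; ring).
rewrite partial_sum_plus, partial_sum_scal; auto using continuous_circle_scal.
ring.
Qed.

Lemma continuous_circle_e n : continuous_circle (e_ n).
Proof.
split; intros t.
- unfold e_; rewrite Rmult_plus_distr_l.
  destruct (Z_le_dec 0 n) as [h|h].
  + replace (IZR n * (2 * PI)) with (2 * INR (Z.to_nat n) * PI)
      by (rewrite INR_IZR_INZ, Z2Nat.id by lia; ring).
    now rewrite cos_period, sin_period.
  + rewrite <- (cos_period (IZR n * t + IZR n * (2 * PI)) (Z.to_nat (- n))),
      <- (sin_period (IZR n * t + IZR n * (2 * PI)) (Z.to_nat (- n))).
    rewrite INR_IZR_INZ, Z2Nat.id, opp_IZR by lia.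
    f_equal; f_equal; ring.
- apply continuous_Cpair; simpl;
  apply (ex_derive_continuous (V := R_NormedModule)); auto_derive; auto.
Qed.

Lemma e_mult m n t : Cmult (e_ m t) (e_ n t) = e_ (m + n) t.
Proof.
unfold e_, Cmult; simpl; rewrite plus_IZR, Rmult_plus_distr_r, cos_plus, sin_plus.
f_equal; ring.
Qed.

Lemma e_conj n t : Cconj (e_ n t) = e_ (- n) t.
Proof.
unfold e_, Cconj; simpl.
now rewrite opp_IZR, Ropp_mult_distr_l_reverse, cos_neg, sin_neg.
Qed.

Lemma e_minus n x t : e_ n (x - t) = Cmult (e_ n x) (Cconj (e_ n t)).
Proof.
unfold e_, Cconj, Cmult; simpl.
rewrite Rmult_minus_distr_l, cos_minus, sin_minus; f_equal; ring.
Qed.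

Lemma e_0 t : e_ 0 t = RtoC 1.
Proof. unfold e_; rewrite Rmult_0_l, cos_0, sin_0; reflexivity. Qed.

Lemma CInt_e n : n <> 0%Z -> CInt (e_ n) 0 (2 * PI) = RtoC 0.
Proof.
intros hn; assert (hz : IZR n <> 0) by (now apply not_0_IZR).
assert (hp := proj1 (continuous_circle_e n) 0).
unfold e_ in hp; injection hp; intros hs hc; clear hp.
rewrite Rplus_0_l, Rmult_0_r in hs, hc.
unfold CInt, e_, RtoC; simpl; f_equal; apply is_RInt_unique.
- replace 0 with (minus (sin (IZR n * (2 * PI)) / IZR n) (sin (IZR n * 0) / IZR n)) at 2
    by (unfold minus, plus, opp; simpl; rewrite hs, Rmult_0_r; field; auto).
  apply (is_RInt_derive (V := R_CompleteNormedModule)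
    (fun t => sin (IZR n * t) / IZR n)).
  + intros t _; auto_derive; [auto|field; auto].
  + intros t _; apply (ex_derive_continuous (V := R_NormedModule)); auto_derive; auto.
- replace 0 with (minus (- cos (IZR n * (2 * PI)) / IZR n) (- cos (IZR n * 0) / IZR n)) at 2
    by (unfold minus, plus, opp; simpl; rewrite hc, Rmult_0_r; field; auto).
  apply (is_RInt_derive (V := R_CompleteNormedModule)
    (fun t => - cos (IZR n * t) / IZR n)).
  + intros t _; auto_derive; [auto|field; auto].
  + intros t _; apply (ex_derive_continuous (V := R_NormedModule)); auto_derive; auto.
Qed.

Lemma fourier_coef_e m n :
  fourier_coef (e_ m) n = if Z.eq_dec m n then RtoC 1 else RtoC 0.
Proof.
assert (hp := two_PI_pos).
assert (h0 : RtoC (2 * PI) <> RtoC 0) by (apply RtoC_neq0; lra).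
unfold fourier_coef.
rewrite (CInt_ext _ (e_ (m - n))) by (intros t; now rewrite e_conj, e_mult).
destruct (Z.eq_dec m n) as [->|h].
- rewrite Z.sub_diag, (CInt_ext _ (fun _ => RtoC 1)) by apply e_0.
  unfold CInt; simpl; rewrite !RInt_const.
  unfold scal; simpl; unfold mult; simpl.
  replace ((2 * PI - 0) * 1, (2 * PI - 0) * 0) with (RtoC (2 * PI))
    by (unfold RtoC; f_equal; ring).
  now field.
- rewrite CInt_e by lia; now field.
Qed.

Lemma partial_sum_0 f t : partial_sum 0 f t = fourier_coef f 0.
Proof.
unfold partial_sum; simpl; rewrite sum_O; simpl.
rewrite e_0; ring.
Qed.

(** Raising [k] shifts the index [i = j + k] by one: the first and last terms are the two new
    frequencies and the middle ones are reindexed. This recursion drives the inductions on [k]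
    below. *)
Lemma partial_sum_S k f t :
  partial_sum (S k) f t =
  Cplus (partial_sum k f t)
    (Cplus (Cmult (fourier_coef f (Z.of_nat (S k))) (e_ (Z.of_nat (S k)) t))
       (Cmult (fourier_coef f (- Z.of_nat (S k))) (e_ (- Z.of_nat (S k)) t))).
Proof.
unfold partial_sum.
replace (2 * S k)%nat with (S (S (2 * k))) by lia.
rewrite sum_Sn; unfold sum_n at 1; rewrite sum_Sn_m by lia.
rewrite <- sum_n_m_S; fold (sum_n (G := C_AbelianMonoid)).
cbv zeta.
replace (Z.of_nat 0 - Z.of_nat (S k))%Z with (- Z.of_nat (S k))%Z by lia.
replace (Z.of_nat (S (S (2 * k))) - Z.of_nat (S k))%Z with (Z.of_nat (S k)) by lia.
unfold sum_n.
rewrite (sum_n_m_ext (G := C_AbelianMonoid)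
  (fun i => let j := (Z.of_nat (S i) - Z.of_nat (S k))%Z in
            Cmult (fourier_coef f j) (e_ j t))
  (fun i => let j := (Z.of_nat i - Z.of_nat k)%Z in
            Cmult (fourier_coef f j) (e_ j t))).
- unfold plus; simpl; ring.
- intros i; replace (Z.of_nat (S i) - Z.of_nat (S k))%Z
    with (Z.of_nat i - Z.of_nat k)%Z by lia; reflexivity.
Qed.

(** * Trigonometric polynomials *)

Lemma continuous_circle_partial_sum k f : continuous_circle (partial_sum k f).
Proof.
induction k as [|k IH].
- replace (partial_sum 0 f) with (fun t => Cmult (fourier_coef f 0) (e_ 0 t)).
  + apply continuous_circle_scal, continuous_circle_e.
  + apply functional_extensionality; intros t.
    rewrite partial_sum_0, e_0; ring.
- rewrite (functional_extensionality _ _ (partial_sum_S k f)).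
  apply continuous_circle_plus; [exact IH|].
  apply continuous_circle_plus; apply continuous_circle_scal, continuous_circle_e.
Qed.

Lemma fourier_coef_partial_sum k f j :
  fourier_coef (partial_sum k f) j =
  if Z_le_dec (Z.abs j) (Z.of_nat k) then fourier_coef f j else RtoC 0.
Proof.
induction k as [|k IH].
- replace (partial_sum 0 f) with (fun t => Cmult (fourier_coef f 0) (e_ 0 t)).
  + rewrite fourier_coef_scal, fourier_coef_e by apply continuous_circle_e.
    destruct (Z.eq_dec 0 j) as [<-|h], (Z_le_dec _ _); try lia; ring.
  + apply functional_extensionality; intros t.
    rewrite partial_sum_0, e_0; ring.
- rewrite (functional_extensionality _ _ (partial_sum_S k f)).
  rewrite !fourier_coef_plus, !fourier_coef_scal, !fourier_coef_e, IH;
    auto using continuous_circle_plus, continuous_circle_scal,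
      continuous_circle_e, continuous_circle_partial_sum.
  destruct (Z.eq_dec (Z.of_nat (S k)) j) as [<-|h1],
    (Z.eq_dec (- Z.of_nat (S k)) _) as [h2|h2];
  repeat (destruct (Z_le_dec _ _)); try lia; try ring.
  rewrite <- h2; ring.
Qed.

Lemma partial_sum_coef_ext k f g t :
  (forall j, (Z.abs j <= Z.of_nat k)%Z -> fourier_coef f j = fourier_coef g j) ->
  partial_sum k f t = partial_sum k g t.
Proof.
induction k as [|k IH]; intros H.
- rewrite !partial_sum_0; apply H; lia.
- rewrite !partial_sum_S, IH, !H by (intros; try apply H; lia); reflexivity.
Qed.

Lemma partial_sum_stable k K f t : (K <= k)%nat ->
  (forall j, (Z.of_nat K < Z.abs j)%Z -> fourier_coef f j = RtoC 0) ->
  partial_sum k f t = partial_sum K f t.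
Proof.
intros hk H; induction hk as [|k hk IH]; [reflexivity|].
rewrite partial_sum_S, IH, !H by lia; ring.
Qed.

Lemma partial_sum_vanish k f t :
  (forall j, (Z.abs j <= Z.of_nat k)%Z -> fourier_coef f j = RtoC 0) ->
  partial_sum k f t = RtoC 0.
Proof.
intros H; rewrite (partial_sum_coef_ext k f (fun _ => RtoC 0)).
- induction k as [|k IH].
  + now rewrite partial_sum_0, fourier_coef_0.
  + rewrite partial_sum_S, IH, !fourier_coef_0 by (intros; apply H; lia); ring.
- intros j hj; now rewrite H, fourier_coef_0.
Qed.

(** Each of the [2k + 1] terms has modulus at most [2M]. The bound is crude and grows with [k]; the
    accuracies in the block construction are chosen against it. *)
Lemma partial_sum_le k f M t :
  continuous_circle f -> (forall s, Cmod (f s) <= M) ->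
  Cmod (partial_sum k f t) <= 2 * (2 * INR k + 1) * M.
Proof.
intros hf H.
assert (hc := fun j => fourier_coef_bound f j M hf H).
induction k as [|k IH].
- rewrite partial_sum_0; simpl; eapply Rle_trans; [apply hc|lra].
- rewrite partial_sum_S, S_INR.
  eapply Rle_trans; [apply Cmod_triangle|].
  eapply Rle_trans; [apply Rplus_le_compat_l, Cmod_triangle|].
  rewrite !Cmod_mult, !Cmod_e.
  generalize (hc (Z.of_nat (S k))) (hc (- Z.of_nat (S k))%Z); lra.
Qed.

(** Degree at most [K] is encoded as being fixed by [S_K]: closure under linear operations is then
    the linearity of [S_K], and the vanishing of higher coefficients is read off those of a partial
    sum. *)
Definition trig_poly_deg (K : nat) (f : R -> C) : Prop :=
  continuous_circle f /\ forall t, partial_sum K f t = f t.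

Lemma trig_poly_deg_coef K f j : trig_poly_deg K f ->
  (Z.of_nat K < Z.abs j)%Z -> fourier_coef f j = RtoC 0.
Proof.
intros [_ h] hj; rewrite <- (functional_extensionality _ _ h).
rewrite fourier_coef_partial_sum; destruct (Z_le_dec _ _); [lia|reflexivity].
Qed.

Lemma trig_poly_deg_partial_sum K f k t : trig_poly_deg K f -> (K <= k)%nat ->
  partial_sum k f t = f t.
Proof.
intros h hk; rewrite (partial_sum_stable k K) by
  eauto using trig_poly_deg_coef; apply h.
Qed.

Lemma trig_poly_deg_weaken K K' f : trig_poly_deg K f -> (K <= K')%nat ->
  trig_poly_deg K' f.
Proof.
intros h hk; split; [apply h|intros t].
eapply trig_poly_deg_partial_sum; eassumption.
Qed.

Lemma trig_poly_deg_minus K f g :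
  trig_poly_deg K f -> trig_poly_deg K g ->
  trig_poly_deg K (fun t => Cminus (f t) (g t)).
Proof.
intros [cf hf] [cg hg]; split; [now apply continuous_circle_minus|intros t].
now rewrite partial_sum_minus, hf, hg.
Qed.

Lemma trig_poly_deg_plus K f g :
  trig_poly_deg K f -> trig_poly_deg K g ->
  trig_poly_deg K (fun t => Cplus (f t) (g t)).
Proof.
intros [cf hf] [cg hg]; split; [now apply continuous_circle_plus|intros t].
now rewrite partial_sum_plus, hf, hg.
Qed.

Lemma trig_poly_deg_scal K c f :
  trig_poly_deg K f -> trig_poly_deg K (fun t => Cmult c (f t)).
Proof.
intros [cf hf]; split; [now apply continuous_circle_scal|intros t].
now rewrite partial_sum_scal, hf.
Qed.

Lemma trig_poly_deg_sum K f : trig_poly_deg K (partial_sum K f).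
Proof.
split; [apply continuous_circle_partial_sum|intros t].
apply partial_sum_coef_ext; intros j hj; rewrite fourier_coef_partial_sum.
destruct (Z_le_dec _ _); [reflexivity|lia].
Qed.

Lemma trig_poly_deg_0 K : trig_poly_deg K (fun _ => RtoC 0).
Proof.
split; [apply continuous_circle_0|intros t].
apply partial_sum_vanish; intros; apply fourier_coef_0.
Qed.

Lemma trig_poly_deg_e j : trig_poly_deg (Z.to_nat (Z.abs j)) (e_ j).
Proof.
split; [apply continuous_circle_e|intros t].
destruct (Z.to_nat (Z.abs j)) as [|k] eqn:hj.
- assert (j = 0%Z) as -> by lia.
  now rewrite partial_sum_0, fourier_coef_e, e_0.
- rewrite partial_sum_S, partial_sum_vanish, !fourier_coef_e.
  + destruct (Z.eq_dec j (Z.of_nat (S k))) as [->|h1],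
      (Z.eq_dec _ (- Z.of_nat (S k))) as [h2|h2]; try lia; try ring.
    rewrite <- h2; ring.
  + intros i hi; rewrite fourier_coef_e.
    destruct (Z.eq_dec j i); [lia|reflexivity].
Qed.

(** * Density of the trigonometric polynomials *)

(** A syntactic form of trigonometric polynomials, without degree: products with exponentials and
    convolutions are treated term by term, by induction. *)
Inductive exp_sum : (R -> C) -> Prop :=
| exp_sum_0 : exp_sum (fun _ => RtoC 0)
| exp_sum_add c j f : exp_sum f ->
    exp_sum (fun t => Cplus (Cmult c (e_ j t)) (f t)).

Lemma exp_sum_ext f g : exp_sum f -> (forall t, f t = g t) -> exp_sum g.
Proof. intros hf h; now rewrite <- (functional_extensionality _ _ h). Qed.

Lemma exp_sum_plus f g : exp_sum f -> exp_sum g ->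
  exp_sum (fun t => Cplus (f t) (g t)).
Proof.
intros hf hg; induction hf as [|c j f hf IH].
- apply (exp_sum_ext g); [exact hg|intros t; ring].
- eapply exp_sum_ext; [apply (exp_sum_add c j), IH|intros t; cbv beta; ring].
Qed.

Lemma exp_sum_mult_e c k f : exp_sum f ->
  exp_sum (fun t => Cmult (Cmult c (e_ k t)) (f t)).
Proof.
intros hf; induction hf as [|d j f hf IH].
- eapply exp_sum_ext; [apply exp_sum_0|intros t; cbv beta; ring].
- eapply exp_sum_ext; [apply (exp_sum_add (Cmult c d) (k + j)), IH|].
  intros t; cbv beta; rewrite <- e_mult; ring.
Qed.

(** Equal to [2^n cos(u/2)^(2n)]: the de la Vallée Poussin kernel, up to normalisation. *)
Definition cos_kernel (n : nat) (u : R) : R := (1 + cos u) ^ n.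

Lemma cos_kernel_ge0 n u : 0 <= cos_kernel n u.
Proof. apply pow_le; generalize (COS_bound u); lra. Qed.

Lemma continuous_cos_kernel n x t : continuous (fun t => cos_kernel n (x - t)) t.
Proof.
unfold cos_kernel; apply (ex_derive_continuous (V := R_NormedModule)).
auto_derive; auto.
Qed.

(** Since [cos = (e_1 + e_{-1}) / 2], multiplication by [1 + cos] adds to the kernel two halved
    copies with frequencies shifted by 1 and -1. *)
Lemma exp_sum_cos_kernel n : exp_sum (fun u => RtoC (cos_kernel n u)).
Proof.
induction n as [|n IH].
- eapply exp_sum_ext; [apply (exp_sum_add (RtoC 1) 0), exp_sum_0|].
  intros t; cbv beta; unfold cos_kernel; simpl pow; rewrite e_0; ring.
- eapply exp_sum_ext.
  + apply exp_sum_plus; [exact IH|].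
    apply exp_sum_plus; [apply (exp_sum_mult_e (RtoC (/ 2)) 1), IH|].
    apply (exp_sum_mult_e (RtoC (/ 2)) (-1)), IH.
  + intros t; unfold cos_kernel, e_.
    replace (IZR (-1) * t) with (- t) by ring.
    rewrite Rmult_1_l, cos_neg, sin_neg.
    unfold RtoC, Cplus, Cmult; simpl; f_equal; field.
Qed.

Definition circ_conv (f Q : R -> C) (x : R) : C :=
  CInt (fun t => Cmult (f t) (Q (x - t))) 0 (2 * PI).

Lemma exp_sum_continuous Q : exp_sum Q -> forall x t, continuous (fun t => Q (x - t)) t.
Proof.
intros hQ x t.
assert (h : continuous Q (x - t)).
{ induction hQ as [|c j f hf IH]; [apply continuous_const|].
  apply continuous_Cadd; [|exact IH].
  apply continuous_Cmul; [apply continuous_const|apply continuous_circle_e]. }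
refine (continuous_comp (fun t => x - t) Q t _ h).
apply (ex_derive_continuous (V := R_NormedModule)); auto_derive; auto.
Qed.

(** Convolving [f] with [e_j] gives [2 pi] times the [j]-th coefficient of [f], times [e_j]. Each
    term of [Q] thus yields one exponential, weighted by a coefficient of [f], whence both the
    degree bound and the preservation of zero coefficients. *)
Lemma circ_conv_trig_poly f Q : continuous_circle f -> exp_sum Q ->
  exists K, trig_poly_deg K (circ_conv f Q) /\
    forall j, fourier_coef f j = RtoC 0 ->
      fourier_coef (circ_conv f Q) j = RtoC 0.
Proof.
intros hf hQ; induction hQ as [|c j Q hQ [K [hK hs]]].
- exists O; replace (circ_conv f _) with (fun _ : R => RtoC 0).
  + split; [apply trig_poly_deg_0|intros; apply fourier_coef_0].
  + apply functional_extensionality; intros x; unfold circ_conv.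
    rewrite (CInt_ext _ (fun t => Cmult (RtoC 0) (f t))) by (intros; ring).
    rewrite CInt_scal by apply hf; ring.
- assert (E : circ_conv f (fun t => Cplus (Cmult c (e_ j t)) (Q t)) =
    fun x => Cplus (Cmult (Cmult (Cmult c (RtoC (2 * PI))) (fourier_coef f j))
                      (e_ j x)) (circ_conv f Q x)).
  { apply functional_extensionality; intros x; unfold circ_conv.
    rewrite (CInt_ext _ (fun t => Cplus (Cmult (Cmult c (e_ j x))
      (Cmult (f t) (Cconj (e_ j t)))) (Cmult (f t) (Q (x - t)))))
      by (intros t; rewrite e_minus; ring).
    rewrite CInt_plus, CInt_scal.
    - unfold fourier_coef; f_equal; field.
      apply RtoC_neq0; generalize two_PI_pos; lra.
    - intros t; apply continuous_Cmul; [apply hf|apply continuous_e_conj].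
    - intros t; apply continuous_Cmul; [apply continuous_const|].
      apply continuous_Cmul; [apply hf|apply continuous_e_conj].
    - intros t; apply continuous_Cmul; [apply hf|now apply exp_sum_continuous]. }
  rewrite E; exists (max K (Z.to_nat (Z.abs j))); split.
  + apply trig_poly_deg_plus.
    * eapply trig_poly_deg_scal, trig_poly_deg_weaken;
        [apply trig_poly_deg_e|lia].
    * eapply trig_poly_deg_weaken; [apply hK|lia].
  + intros i hi.
    rewrite fourier_coef_plus, fourier_coef_scal, fourier_coef_e, hs
      by (try apply continuous_circle_scal; try apply continuous_circle_e;
          try apply hK; exact hi).
    destruct (Z.eq_dec j i) as [->|_]; [rewrite hi|]; ring.
Qed.

(* [(1 + cos u)^n * (1 - (n + 1) * (1 - cos u))] is the derivative of the
   periodic function [sin u * (1 + cos u)^n]. *)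
Lemma RInt_cos_kernel_defect n x :
  INR (S n) * RInt (fun t => (1 - cos (x - t)) * cos_kernel n (x - t)) 0 (2 * PI)
  = RInt (fun t => cos_kernel n (x - t)) 0 (2 * PI).
Proof.
set (g := fun t => cos_kernel n (x - t)).
set (h := fun t => (1 - cos (x - t)) * cos_kernel n (x - t)).
assert (cg : forall t, continuous g t) by (intros; apply continuous_cos_kernel).
assert (ch : forall t, continuous h t).
{ intros t; unfold h, cos_kernel.
  apply (ex_derive_continuous (V := R_NormedModule)); auto_derive; auto. }
assert (H : is_RInt (fun t => INR (S n) * h t - g t) 0 (2 * PI) 0).
{ replace 0 with (minus (sin (x - 2 * PI) * cos_kernel n (x - 2 * PI))
    (sin (x - 0) * cos_kernel n (x - 0))) at 2.
  - apply (is_RInt_derive (V := R_CompleteNormedModule)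
      (fun t => sin (x - t) * cos_kernel n (x - t))).
    + intros t _; unfold h, g, cos_kernel; auto_derive; [auto|].
      change (x + - t) with (x - t); destruct n as [|n]; [simpl; ring|].
      rewrite !S_INR; simpl pred; simpl pow.
      assert (Hs := sin2_cos2 (x - t)); unfold Rsqr in Hs.
      set (c := cos (x - t)) in *; set (s := sin (x - t)) in *.
      set (u := (1 + c) ^ n).
      assert (E : s * s = (1 - c) * (1 + c)) by lra.
      transitivity (- c * ((1 + c) * u) + s * s * ((INR n + 1) * u)); [ring|].
      rewrite E; ring.
    + intros t _; unfold h, g, cos_kernel.
      apply (ex_derive_continuous (V := R_NormedModule)); auto_derive; auto.
  - replace (x - 0) with (x - 2 * PI + 2 * INR 1 * PI) by (simpl; ring).
    unfold cos_kernel; rewrite cos_period, sin_period.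
    unfold minus, plus, opp; simpl; ring. }
apply (is_RInt_unique (V := R_CompleteNormedModule)) in H.
rewrite (RInt_minus (V := R_CompleteNormedModule) (fun t => INR (S n) * h t)) in H.
- rewrite (RInt_scal (V := R_CompleteNormedModule) h) in H by now apply ex_RInt_cont.
  unfold minus, plus, opp, scal in H; simpl in H; unfold mult in H; simpl in H.
  simpl; lra.
- apply (ex_RInt_scal (V := R_NormedModule) h); now apply ex_RInt_cont.
- now apply ex_RInt_cont.
Qed.

Lemma continuous_cos_kernel_defect n x t :
  continuous (fun t => (1 - cos (x - t)) * cos_kernel n (x - t)) t.
Proof.
apply (continuous_mult (K := R_AbsRing)); [|apply continuous_cos_kernel].
apply (ex_derive_continuous (V := R_NormedModule)); auto_derive; auto.
Qed.

(** Writing [1 + cos = 2 - (1 - cos)], the mass for [n + 1] is twice the mass [c] for [n] minus the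
    defect integral [c / (n + 1)]. The induction also gives independence of [x]. *)
Lemma cos_kernel_mass n :
  exists c, 0 < c /\ forall x, RInt (fun t => cos_kernel n (x - t)) 0 (2 * PI) = c.
Proof.
assert (hp := two_PI_pos).
induction n as [|n [c [hc IH]]].
- exists (2 * PI); split; [exact hp|intros x].
  unfold cos_kernel; simpl; rewrite RInt_const.
  unfold scal; simpl; unfold mult; simpl; ring.
- assert (hn := lt_0_INR (S n) ltac:(lia)); rewrite S_INR in hn.
  assert (hn0 := pos_INR n).
  exists ((2 - / (INR n + 1)) * c); split.
  { apply Rmult_lt_0_compat; [|exact hc].
    assert (/ (INR n + 1) <= / 1) by (apply Rinv_le_contravar; lra); lra. }
  intros x.
  assert (H := RInt_cos_kernel_defect n x); rewrite IH, S_INR in H.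
  set (D := RInt _ _ _ : R) in H.
  assert (HD : D = c / (INR n + 1)) by (rewrite <- H; field; lra).
  replace (_ * c) with (2 * c - D) by (rewrite HD; field; lra).
  rewrite <- (IH x); unfold D.
  set (g := fun t => cos_kernel n (x - t)).
  set (h := fun t => (1 - cos (x - t)) * cos_kernel n (x - t)).
  assert (eg : ex_RInt g 0 (2 * PI))
    by (apply ex_RInt_cont; intros; apply continuous_cos_kernel).
  assert (eh : ex_RInt h 0 (2 * PI))
    by (apply ex_RInt_cont; intros; apply continuous_cos_kernel_defect).
  rewrite (RInt_ext _ (fun t => minus (scal 2 (g t)) (h t))).
  + rewrite (RInt_minus (V := R_CompleteNormedModule)),
      (RInt_scal (V := R_CompleteNormedModule) g);
      auto; now apply (ex_RInt_scal (V := R_NormedModule) g).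
  + intros t _; unfold g, h, cos_kernel, minus, plus, opp, scal; simpl.
    unfold mult; simpl; ring.
Qed.

Lemma ball_norm_C (z w : C) (e : R) :
  ball_norm (K := C_AbsRing) (V := C_NormedModule) z e w <-> Cmod (Cminus w z) < e.
Proof. reflexivity. Qed.

Lemma periodic_shift (t x : R) :
  exists m : Z, - PI <= x - (t + IZR m * (2 * PI)) <= PI.
Proof.
assert (hp := PI_RGT_0).
set (q := (x - t + PI) / (2 * PI)).
exists (up q - 1)%Z; rewrite minus_IZR.
destruct (archimed q) as [h1 h2].
assert (E : x - t + PI = q * (2 * PI)) by (unfold q; field; lra).
set (u := IZR (up q)) in *; split; nra.
Qed.

Lemma cos_shift x m : cos (x + IZR m * (2 * PI)) = cos x.
Proof.
destruct (continuous_circle_e 1) as [hp _].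
assert (H := periodic_Z (e_ 1) m x hp); unfold e_ in H.
injection H; rewrite !Rmult_1_l; auto.
Qed.

(* Korovkin's form of uniform continuity: it only involves the test function
   [1 - cos]. *)
Lemma continuous_circle_modulus f eta :
  continuous_circle f -> 0 < eta ->
  exists A, 0 <= A /\
    forall x t, Cmod (Cminus (f x) (f t)) <= eta + A * (1 - cos (x - t)).
Proof.
intros hf heta; assert (hp := PI_RGT_0).
destruct (continuous_circle_bounded f hf) as [M HM].
assert (hM : 0 <= M) by (eapply Rle_trans; [apply Cmod_ge_0|apply (HM 0)]).
destruct hf as [pf cf].
(* After reduction modulo the period, [x] lies in [[-PI, PI]] and [t] within [PI] of [x], so this
   interval contains both. *)
destruct (unifcont_normed_1d (K := C_AbsRing) (V := C_NormedModule) f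
  (- (2 * PI)) (2 * PI) (fun x _ => cf x) (mkposreal eta heta)) as [d hd].
set (d' := Rmin d PI).
assert (hd'0 : 0 < d') by (apply Rmin_pos; [apply cond_pos|lra]).
assert (hd'1 : d' <= d) by apply Rmin_l.
assert (hd'2 : d' <= PI) by apply Rmin_r.
assert (hc : cos d' < 1).
{ rewrite <- cos_0; apply cos_decreasing_1; lra. }
(* When [x - t], reduced to [[-PI, PI]], has modulus at least [d'], one has
   [1 - cos (x - t) >= 1 - cos d'], and this constant makes the second term exceed the trivial bound
   [2 * M]. *)
exists (2 * M / (1 - cos d')); split.
{ apply Rmult_le_pos; [lra|left; apply Rinv_0_lt_compat; lra]. }
assert (key : forall x t, 0 <= x <= PI \/ - PI <= x <= 0 -> - PI <= x - t <= PI ->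
  Cmod (Cminus (f x) (f t)) <= eta + 2 * M / (1 - cos d') * (1 - cos (x - t))).
{ intros x t hx ht.
  assert (h0 : 0 <= 1 - cos (x - t)) by (generalize (COS_bound (x - t)); lra).
  destruct (Rlt_le_dec (Rabs (x - t)) d') as [h|h].
  - assert (H : Cmod (Cminus (f x) (f t)) < eta).
    { apply (hd t x).
      - destruct hx; lra.
      - destruct hx; lra.
      - apply Rlt_le_trans with d'; [exact h|exact hd'1]. }
    assert (0 <= 2 * M / (1 - cos d') * (1 - cos (x - t))); [|lra].
    apply Rmult_le_pos; [|exact h0].
    apply Rmult_le_pos; [lra|left; apply Rinv_0_lt_compat; lra].
  - assert (hcos : cos (x - t) <= cos d').
    { destruct (Rle_dec 0 (x - t)) as [h1|h1].
      - rewrite Rabs_pos_eq in h by lra.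
        apply cos_decr_1; lra.
      - rewrite Rabs_left in h by lra; rewrite <- cos_neg.
        apply cos_decr_1; lra. }
    assert (2 * M <= 2 * M / (1 - cos d') * (1 - cos (x - t))).
    { replace (2 * M / (1 - cos d') * (1 - cos (x - t)))
        with (2 * M * ((1 - cos (x - t)) / (1 - cos d'))) by (field; lra).
      rewrite <- (Rmult_1_r (2 * M)) at 1.
      apply Rmult_le_compat_l; [lra|].
      apply Rle_div_r; lra. }
    unfold Cminus; eapply Rle_trans; [apply Cmod_triangle|]; rewrite Cmod_opp.
    generalize (HM x) (HM t); lra. }
intros x t.
(* Two successive reductions: [x] is brought near 0, and [t] is then brought near the new [x]. *)
destruct (periodic_shift x 0) as [m hm].
rewrite <- (periodic_Z f m x pf).
set (x' := x + IZR m * (2 * PI)) in *.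
destruct (periodic_shift t x') as [l hl].
rewrite <- (periodic_Z f l t pf).
replace (cos (x - t)) with (cos (x' - (t + IZR l * (2 * PI)))).
- apply key; [destruct (Rle_dec 0 x'); lra|exact hl].
- replace (x' - (t + IZR l * (2 * PI))) with (x - t + IZR (m - l) * (2 * PI))
    by (unfold x'; rewrite minus_IZR; ring).
  apply cos_shift.
Qed.

(** The approximant is the convolution with [cos_kernel n] divided by its mass, so the error at [x]
    is a weighted mean of [f x - f t]. In the bound [eta + A * (1 - cos (x - t))] the second term
    has mean [A / (n + 1)], by the defect identity. *)
Lemma trig_poly_dense f eps :
  continuous_circle f -> 0 < eps ->
  exists p K, trig_poly_deg K p /\
    (forall j, fourier_coef f j = RtoC 0 -> fourier_coef p j = RtoC 0) /\
    forall x, Cmod (Cminus (f x) (p x)) <= eps.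
Proof.
intros hf heps.
(* The two contributions are each at most [eps / 4], and [CInt_bound] doubles their sum. *)
destruct (continuous_circle_modulus f (eps / 4) hf) as [A [hA HA]]; [lra|].
destruct (INR_unbounded (4 * A / eps)) as [n hn].
destruct (cos_kernel_mass n) as [c [hc Hc]].
destruct (circ_conv_trig_poly f _ hf (exp_sum_cos_kernel n)) as [K [hK hs]].
set (P := circ_conv f _) in *.
exists (fun x => Cmult (RtoC (/ c)) (P x)), K; split; [|split].
- now apply trig_poly_deg_scal.
- intros j hj; rewrite fourier_coef_scal, hs by (apply hK || exact hj); ring.
- intros x.
  assert (cQ : forall t, continuous (fun t => RtoC (cos_kernel n (x - t))) t)
    by apply (exp_sum_continuous _ (exp_sum_cos_kernel n)).
  assert (E : Cminus (f x) (Cmult (RtoC (/ c)) (P x)) =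
    Cmult (RtoC (/ c)) (CInt (fun t =>
      Cmult (Cminus (f x) (f t)) (RtoC (cos_kernel n (x - t)))) 0 (2 * PI))).
  { rewrite (CInt_ext _ (fun t => Cplus
      (Cmult (f x) (RtoC (cos_kernel n (x - t))))
      (Cmult (Copp (RtoC 1)) (Cmult (f t) (RtoC (cos_kernel n (x - t)))))))
      by (intros; ring).
    rewrite CInt_plus, !CInt_scal.
    - fold (circ_conv f (fun u => RtoC (cos_kernel n u)) x); fold P.
      replace (CInt (fun t => RtoC (cos_kernel n (x - t))) 0 (2 * PI)) with (RtoC c).
      + rewrite RtoC_inv by lra; field; apply RtoC_neq0; lra.
      + unfold CInt; simpl; rewrite Hc, RInt_const.
        unfold scal; simpl; unfold mult; simpl; unfold RtoC; f_equal; ring.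
    - intros t; apply continuous_Cmul; [apply hf|apply cQ].
    - exact cQ.
    - intros t; apply continuous_Cmul; [apply continuous_const|apply cQ].
    - intros t; apply continuous_Cmul; [apply continuous_const|].
      apply continuous_Cmul; [apply hf|apply cQ]. }
  rewrite E, Cmod_mult, Cmod_R, Rabs_pos_eq
    by (left; now apply Rinv_0_lt_compat).
  set (g := fun t => cos_kernel n (x - t)).
  set (h := fun t => (1 - cos (x - t)) * cos_kernel n (x - t)).
  assert (cg : forall t, continuous g t) by (intros; apply continuous_cos_kernel).
  assert (ch : forall t, continuous h t)
    by (intros; apply continuous_cos_kernel_defect).
  assert (eg := ex_RInt_cont g 0 (2 * PI) cg).
  assert (eh := ex_RInt_cont h 0 (2 * PI) ch).
  assert (hx1 := ex_RInt_scal (V := R_NormedModule) g 0 (2 * PI) (eps / 4) eg).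
  assert (hx2 := ex_RInt_scal (V := R_NormedModule) h 0 (2 * PI) A eh).
  assert (B := CInt_bound (fun t =>
      Cmult (Cminus (f x) (f t)) (RtoC (cos_kernel n (x - t))))
    (fun t => plus (scal (eps / 4) (g t)) (scal A (h t))) 0 (2 * PI)).
  rewrite (RInt_plus (V := R_CompleteNormedModule)),
    !(RInt_scal (V := R_CompleteNormedModule)) in B by auto.
  assert (D := RInt_cos_kernel_defect n x).
  fold g h in D; rewrite (Hc x : RInt g _ _ = c) in B, D.
  assert (hn1 : 0 < INR (S n)) by (apply lt_0_INR; lia).
  set (I := RInt h 0 (2 * PI) : R) in B, D.
  assert (HD : I = c / INR (S n)) by (rewrite <- D; field; lra).
  rewrite HD in B.
  apply Rle_trans with (/ c * (2 * (eps / 4 * c + A * (c / INR (S n))))).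
  + apply Rmult_le_compat_l; [left; now apply Rinv_0_lt_compat|].
    apply B.
    * generalize two_PI_pos; lra.
    * intros t; apply continuous_Cmul; [|apply cQ].
      apply (continuous_Cadd (fun _ => f x) (fun t => Copp (f t)));
        [apply continuous_const|].
      apply continuous_Cpair;
        apply (continuous_opp (V := R_NormedModule));
        [apply continuous_Re|apply continuous_Im]; apply hf.
    * intros t; apply (continuous_plus (V := R_NormedModule));
        apply (continuous_scal_r (V := R_NormedModule)); auto.
    * intros t; rewrite Cmod_mult, Cmod_R, Rabs_pos_eq by apply cos_kernel_ge0.
      unfold plus, scal; simpl; unfold mult; simpl; unfold g, h.
      eapply Rle_trans; [apply Rmult_le_compat_r;
        [apply cos_kernel_ge0|apply HA]|]; apply Req_le; ring.
  + replace (/ c * _) with (eps / 2 + 2 * (A / INR (S n))) by (field; lra).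
    assert (A / INR (S n) <= eps / 4); [|lra].
    apply Rle_div_l; [exact hn1|].
    rewrite S_INR.
    assert (4 * A < INR n * eps) by (apply Rlt_div_l; [exact heps|exact hn]).
    lra.
Qed.

(** * Blocks *)

Lemma in_U_uniform f : continuous_circle f ->
  (forall eps, 0 < eps -> exists K, forall k t, (K <= k)%nat ->
    Cmod (Cminus (partial_sum k f t) (f t)) <= eps) -> in_U f.
Proof.
intros hf H; split; [exact hf|].
apply is_lim_seq_spec; intros eps.
destruct (H (eps / 2)) as [K HK]; [generalize (cond_pos eps); lra|].
exists K; intros k hk.
rewrite Rminus_0_r, Rabs_pos_eq by (apply (sup_norm_ge0 0), error_bounded, hf).
apply Rle_lt_trans with (eps / 2); [|generalize (cond_pos eps); lra].
apply (sup_norm_le 0); intros t; now apply HK.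
Qed.

Lemma trig_poly_deg_in_U K f : trig_poly_deg K f -> in_U f.
Proof.
intros hf; apply in_U_uniform; [apply hf|intros eps heps; exists K; intros k t hk].
rewrite (trig_poly_deg_partial_sum K) by assumption.
replace (Cminus (f t) (f t)) with (RtoC 0) by ring; rewrite Cmod_0; lra.
Qed.

Lemma Cmod_minus_sym z w : Cmod (Cminus z w) = Cmod (Cminus w z).
Proof. rewrite <- Cmod_opp; f_equal; ring. Qed.

Lemma Cmod_minus_le z w : Cmod (Cminus z w) <= Cmod z + Cmod w.
Proof. unfold Cminus; rewrite <- (Cmod_opp w); apply Cmod_triangle. Qed.

Lemma Cmod_minus_triangle x y z :
  Cmod (Cminus x z) <= Cmod (Cminus x y) + Cmod (Cminus y z).
Proof.
replace (Cminus x z) with (Cplus (Cminus x y) (Cminus y z)) by ring.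
apply Cmod_triangle.
Qed.

(** The inclusion of [U_Lambda] in [C_Lambda] is immediate, so only the converse can fail; excluded
    middle extracts a function and a gap exceeded at arbitrarily late indices. *)
Lemma not_UC_set_witness (Lambda : Z -> Prop) : ~ UC_set Lambda ->
  exists f eps, in_C_Lambda Lambda f /\ 0 < eps /\
    forall K, exists k t, (K <= k)%nat /\
      eps < Cmod (Cminus (partial_sum k f t) (f t)).
Proof.
intros H; apply NNPP; intros H1; apply H; intros f; split.
- intros [[hf _] hs]; now split.
- intros [hf hs]; split; [|exact hs].
  apply in_U_uniform; [exact hf|intros eps heps].
  apply NNPP; intros H2; apply H1; exists f, eps.
  split; [now split|split; [exact heps|intros K]].
  apply NNPP; intros H3; apply H2; exists K; intros k t hk.
  apply Rnot_lt_le; intros h; apply H3; now exists k, t.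
Qed.

(** The bounds 1 and [1 / 2] express a normalisation in [U]; with [1 / 2] below the supremum 1, no
    maximising pair [k], [t] has to be produced. *)
Record block (Lambda : Z -> Prop) (N K : nat) (eta : R) (h : R -> C) : Prop :=
  Block {
    block_lt : (N < K)%nat;
    block_deg : trig_poly_deg K h;
    block_low : forall j, (Z.abs j <= Z.of_nat N)%Z -> fourier_coef h j = RtoC 0;
    block_spectrum : spectrum_in Lambda h;
    block_small : forall t, Cmod (h t) <= eta;
    block_partial_le : forall k t, Cmod (partial_sum k h t) <= 1;
    block_partial_large : exists k t, 1 / 2 < Cmod (partial_sum k h t)
  }.

(** The point is the order of quantifiers: [eps] depends on the bad function alone, while [N] and
    [delta] are arbitrary. Dividing by the [U]-norm, which exceeds [eps], therefore keeps the sup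
    norm as small as desired. *)
Lemma small_poly_large_partial_sum (Lambda : Z -> Prop) : ~ UC_set Lambda ->
  exists eps, 0 < eps /\ forall N delta, 0 < delta ->
    exists h K, (N < K)%nat /\ trig_poly_deg K h /\
      (forall j, (Z.abs j <= Z.of_nat N)%Z -> fourier_coef h j = RtoC 0) /\
      spectrum_in Lambda h /\ (forall t, Cmod (h t) <= delta) /\
      exists k t, (1 <= k)%nat /\ eps < Cmod (partial_sum k h t).
Proof.
intros H; destruct (not_UC_set_witness _ H) as (f & eps & [hf hs] & heps & Hk).
exists (eps / 4); split; [lra|intros N delta hdelta].
assert (hN := pos_INR N).
set (L := 2 * (2 * INR N + 1)).
assert (hL : 2 <= L) by (unfold L; lra).
(* The difference [q] of the approximants is bounded by [2 * d] and [S_N q] by [L * (2 * d)]; [d]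
   makes their sum at most both [delta] and [eps / 4]. *)
set (d := Rmin delta (eps / 4) / (2 * (1 + L))).
assert (hm : 0 < Rmin delta (eps / 4)) by (apply Rmin_pos; lra).
assert (hd : 0 < d) by (apply Rdiv_lt_0_compat; lra).
assert (Ed : Rmin delta (eps / 4) = 2 * d * (1 + L)) by (unfold d; field; lra).
assert (hd1 : 2 * d * (1 + L) <= delta) by (rewrite <- Ed; apply Rmin_l).
assert (hd2 : 2 * d * (1 + L) <= eps / 4) by (rewrite <- Ed; apply Rmin_r).
destruct (trig_poly_dense f d hf hd) as (p & K & hp & sp & Hp).
(* Beyond [K] and [N], the sum [S_k] fixes both [p] and [S_N q]. *)
destruct (Hk (max K (S N))) as (k & t0 & hk & Ht0).
assert (hk0 := pos_INR k).
set (M := 2 * (2 * INR k + 1)).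
assert (hM : 0 < M) by (unfold M; lra).
(* The accuracy [d] keeps [q] small; the accuracy [eps / 4 / M], chosen once [k] is known, makes
   [S_k p'] differ from [S_k f] by at most [eps / 4]. *)
destruct (trig_poly_dense f (Rmin d (eps / 4 / M)) hf) as (p' & K' & hp' & sp' & Hp').
{ apply Rmin_pos; [exact hd|apply Rdiv_lt_0_compat; lra]. }
set (q := fun t => Cminus (p' t) (p t)).
assert (hq : trig_poly_deg (max (max K K') (S N)) q).
{ apply trig_poly_deg_minus; eapply trig_poly_deg_weaken; eauto; lia. }
assert (Hq : forall t, Cmod (q t) <= 2 * d).
{ intros t; unfold q; eapply Rle_trans; [apply (Cmod_minus_triangle _ (f t))|].
  rewrite (Cmod_minus_sym (p' t)).
  generalize (Hp t) (Hp' t) (Rmin_l d (eps / 4 / M)); lra. }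
assert (hqN : forall t, Cmod (partial_sum N q t) <= L * (2 * d))
  by (intros t; apply partial_sum_le; [apply hq|exact Hq]).
exists (fun t => Cminus (q t) (partial_sum N q t)), (max (max K K') (S N)).
split; [lia|].
assert (cN := continuous_circle_partial_sum N q).
split; [|split; [|split; [|split]]].
- apply trig_poly_deg_minus; [exact hq|].
  eapply trig_poly_deg_weaken; [apply trig_poly_deg_sum|lia].
- intros j hj.
  rewrite fourier_coef_minus, fourier_coef_partial_sum by (apply hq || exact cN).
  destruct (Z_le_dec _ _); [ring|lia].
- intros j hj.
  assert (hqj : fourier_coef q j = RtoC 0).
  { unfold q; rewrite fourier_coef_minus by (apply hp || apply hp').
    rewrite sp, sp' by (now apply hs); ring. }
  rewrite fourier_coef_minus, fourier_coef_partial_sum, hqj by (apply hq || exact cN).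
  destruct (Z_le_dec _ _); ring.
- intros t; eapply Rle_trans; [apply Cmod_minus_le|].
  generalize (Hq t) (hqN t); lra.
- exists k, t0; split; [lia|].
  rewrite partial_sum_minus by (apply hq || exact cN).
  rewrite (trig_poly_deg_partial_sum N (partial_sum N q) k t0)
    by (apply trig_poly_deg_sum || lia).
  unfold q at 1.
  rewrite partial_sum_minus by (apply hp || apply hp').
  rewrite (trig_poly_deg_partial_sum K p k t0) by (assumption || lia).
  assert (Hk' : Cmod (partial_sum k (fun t => Cminus (f t) (p' t)) t0)
    <= M * (eps / 4 / M)).
  { eapply Rle_trans; [apply (partial_sum_le k _ (eps / 4 / M))|apply Rle_refl].
    - apply continuous_circle_minus; [exact hf|apply hp'].
    - intros s; eapply Rle_trans; [apply Hp'|apply Rmin_r]. }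
  replace (M * (eps / 4 / M)) with (eps / 4) in Hk' by (field; lra).
  rewrite partial_sum_minus in Hk' by (exact hf || apply hp').
  set (z := Cminus _ (partial_sum N q t0)).
  (* Here [z] is the value of [S_k] of the constructed polynomial. The three other terms are bounded
     by [2 * d * L], [eps / 4] and [d], in total by [eps / 2], while the left side exceeds [eps] in
     modulus. *)
  assert (E : Cminus (partial_sum k f t0) (f t0) =
    Cplus z (Cplus (partial_sum N q t0) (Cplus
      (Cminus (partial_sum k f t0) (partial_sum k p' t0))
      (Copp (Cminus (f t0) (p t0)))))) by (unfold z; ring).
  assert (T1 := Cmod_triangle z (Cplus (partial_sum N q t0) (Cplus
      (Cminus (partial_sum k f t0) (partial_sum k p' t0))
      (Copp (Cminus (f t0) (p t0)))))).
  assert (T2 := Cmod_triangle (partial_sum N q t0) (Cplus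
      (Cminus (partial_sum k f t0) (partial_sum k p' t0))
      (Copp (Cminus (f t0) (p t0))))).
  assert (T3 := Cmod_triangle
      (Cminus (partial_sum k f t0) (partial_sum k p' t0))
      (Copp (Cminus (f t0) (p t0)))).
  rewrite <- E in T1; rewrite Cmod_opp in T3.
  generalize (Hp t0) (hqN t0); lra.
Qed.

Lemma block_exists (Lambda : Z -> Prop) : ~ UC_set Lambda ->
  forall N eta, 0 < eta -> exists h K, block Lambda N K eta h.
Proof.
intros H; destruct (small_poly_large_partial_sum _ H) as (eps & heps & Hh).
intros N eta heta.
(* Division by the norm [s > eps] turns the bound [eta * eps] into one below [eta]. *)
destruct (Hh N (eta * eps)) as (h & K & hNK & hK & hl & hs & hb & k & t & hk & Hk).
{ now apply Rmult_lt_0_compat. }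
assert (hU := trig_poly_deg_in_U _ _ hK).
set (s := U_norm h).
assert (hs' : eps < s).
{ eapply Rlt_le_trans; [exact Hk|].
  eapply Rle_trans; [apply sup_norm_ub, partial_sum_bounded|now apply U_norm_ub]. }
exists (fun t => Cmult (RtoC (/ s)) (h t)), K.
assert (his : 0 < / s) by (apply Rinv_0_lt_compat; lra).
assert (hmod : forall z, Cmod (Cmult (RtoC (/ s)) z) = Cmod z / s).
{ intros z; rewrite Cmod_mult, Cmod_R, Rabs_pos_eq by lra; apply Rmult_comm. }
split.
- exact hNK.
- now apply trig_poly_deg_scal.
- intros j hj; rewrite fourier_coef_scal, hl by (apply hK || exact hj); ring.
- intros j hj; rewrite fourier_coef_scal, hs by (apply hK || exact hj); ring.
- intros r; rewrite hmod; apply Rle_div_l; [lra|].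
  eapply Rle_trans; [apply hb|]; apply Rmult_le_compat_l; lra.
- intros i r; rewrite partial_sum_scal, hmod by apply hK.
  apply Rle_div_l; [lra|].
  (* The [U]-norm only sees [k >= 1]; for [k = 0] the partial sum is the mean, a low coefficient,
     hence zero. *)
  destruct i as [|i].
  + rewrite partial_sum_0, hl, Cmod_0 by lia; lra.
  + rewrite Rmult_1_l; eapply Rle_trans; [apply sup_norm_ub, partial_sum_bounded|].
    apply U_norm_ub; [exact hU|lia].
(* If no normalised partial sum exceeded [1 / 2], the norm [s] of [h] would be at most [s / 2]. *)
- apply NNPP; intros Hn.
  assert (s <= s / 2); [|lra].
  apply U_norm_le; intros i hi; apply (sup_norm_le 0); intros r.
  apply Rnot_lt_le; intros hr; apply Hn; exists i, r.
  rewrite partial_sum_scal, hmod by apply hK.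
  apply (Rlt_div_r (1 / 2)); lra.
Qed.

(** Each block starts where the previous one ends. The start 1 matches the range [k >= 1] of the
    supremum in the [U]-norm: every such [k] falls in some band. *)
Lemma block_sequence (Lambda : Z -> Prop) : ~ UC_set Lambda ->
  exists (N : nat -> nat) (h : nat -> R -> C), N O = 1%nat /\
    forall n, block Lambda (N n) (N (S n)) ((/ 2) ^ n) (h n).
Proof.
intros H.
assert (C : forall (N n : nat), exists p : (R -> C) * nat,
  block Lambda N (snd p) ((/ 2) ^ n) (fst p)).
{ intros N n; destruct (block_exists _ H N ((/ 2) ^ n)) as (h & K & hK).
  - apply pow_lt; lra.
  - now exists (h, K). }
set (G := fun N n => proj1_sig (constructive_indefinite_description _ (C N n))).
assert (HG : forall N n, block Lambda N (snd (G N n)) ((/ 2) ^ n) (fst (G N n)))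
  by (intros N n; exact (proj2_sig (constructive_indefinite_description _ (C N n)))).
set (N := fix N n := match n with O => 1%nat | S n => snd (G (N n) n) end).
exists N, (fun n => fst (G (N n) n)); split; [reflexivity|].
intros n; apply HG.
Qed.

(** * Embeddings of [c0] *)

Lemma null_seq_iff a : null_seq a <->
  forall eps, 0 < eps -> exists K, forall n, (K <= n)%nat -> Cmod (a n) < eps.
Proof.
unfold null_seq.
rewrite (filterlim_locally_ball_norm (K := C_AbsRing) (U := C_NormedModule)).
assert (E : forall (e : posreal) n,
  ball_norm (K := C_AbsRing) (V := C_NormedModule) (RtoC 0) e (a n)
  <-> Cmod (a n) < e).
{ intros e n; rewrite ball_norm_C; unfold Cminus; now rewrite Copp_0, Cplus_0_r. }
split; intros H.
- intros eps heps; destruct (H (mkposreal eps heps)) as [K HK].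
  exists K; intros n hn; apply (E (mkposreal eps heps)); now apply HK.
- intros e; destruct (H e (cond_pos e)) as [K HK].
  exists K; intros n hn; apply E; now apply HK.
Qed.

Lemma half_pow_lt eps : 0 < eps -> exists K, forall n, (K <= n)%nat -> (/ 2) ^ n < eps.
Proof.
intros heps; destruct (pow_lt_1_zero (/ 2)) with eps as [K HK];
  [rewrite Rabs_pos_eq; lra|exact heps|].
exists K; intros n hn; rewrite <- (Rabs_pos_eq ((/ 2) ^ n)) by (apply pow_le; lra).
now apply HK.
Qed.

Lemma half_pow_anti m n : (m <= n)%nat -> (/ 2) ^ n <= (/ 2) ^ m.
Proof.
intros H; induction H as [|n H IH]; [lra|].
simpl; generalize (pow_le (/ 2) n); lra.
Qed.

Lemma le_half_pow_0 x c : (forall n, x <= c * (/ 2) ^ n) -> x <= 0.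
Proof.
intros H; apply Rnot_lt_le; intros hx.
assert (hc : 0 < c) by (specialize (H O); simpl in H; lra).
destruct (half_pow_lt (x / c)) as [n hn]; [now apply Rdiv_lt_0_compat|].
specialize (hn n (le_n n)); specialize (H n).
apply Rlt_div_r in hn; lra.
Qed.

Lemma Cmod_minus_eq0 z w : Cmod (Cminus z w) <= 0 -> z = w.
Proof.
intros H; assert (E : Cmod (Cminus z w) = 0)
  by (apply Rle_antisym; [exact H|apply Cmod_ge_0]).
apply Cmod_eq_0 in E; now apply Ceq_minus.
Qed.

(** The limit inherits the rate with the same [c]. Applied pointwise, this gives convergence uniform
    in the coordinate (in [c0]) or in [t] (for the series of blocks). *)
Lemma C_limit_of_geometric_cauchy (u : nat -> C) c :
  (forall k l, Cmod (Cminus (u k) (u l)) <= c * ((/ 2) ^ k + (/ 2) ^ l)) ->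
  exists l, forall k, Cmod (Cminus (u k) l) <= c * (/ 2) ^ k.
Proof.
intros H.
assert (hc : 0 <= c) by (generalize (H O O) (Cmod_ge_0 (Cminus (u O) (u O))); simpl; lra).
assert (K : forall g : C -> R, (forall z w, Rabs (g z - g w) <= Cmod (Cminus z w)) ->
  exists l : R, is_lim_seq (fun n => g (u n)) l).
{ intros g Hg; apply ex_lim_seq_cauchy_corr; intros eps.
  destruct (half_pow_lt (eps / (2 * c + 1))) as [K HK].
  { apply Rdiv_lt_0_compat; [apply cond_pos|lra]. }
  exists K; intros n m hn hm; eapply Rle_lt_trans; [apply Hg|].
  eapply Rle_lt_trans; [apply H|].
  specialize (HK n hn) as h1; specialize (HK m hm) as h2.
  apply Rlt_div_r in h1; [|lra]; apply Rlt_div_r in h2; [|lra].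
  assert (0 < (/ 2) ^ n) by (apply pow_lt; lra).
  assert (0 < (/ 2) ^ m) by (apply pow_lt; lra).
  nra. }
destruct (K (fun z => Re z)) as [x hx].
{ intros z w; exact (re_le_Cmod (Cminus z w)). }
destruct (K (fun z => Im z)) as [y hy].
{ intros z w; exact (abs_Im_le (Cminus z w)). }
exists (x, y); intros k.
apply le_epsilon; intros eps heps.
apply is_lim_seq_spec in hx; apply is_lim_seq_spec in hy.
destruct (hx (mkposreal (eps / 3) ltac:(lra))) as [K1 h1].
destruct (hy (mkposreal (eps / 3) ltac:(lra))) as [K2 h2].
destruct (half_pow_lt (eps / 3 / (c + 1))) as [K3 h3].
{ apply Rdiv_lt_0_compat; lra. }
set (l := max K1 (max K2 K3)).
specialize (h1 l ltac:(lia)); specialize (h2 l ltac:(lia)); specialize (h3 l ltac:(lia)).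
simpl in h1, h2; apply Rlt_div_r in h3; [|lra].
eapply Rle_trans; [apply (Cmod_minus_triangle _ (u l))|].
assert (h4 := H k l).
assert (h5 := Cmod_le_Re_Im (Cminus (u l) (x, y))).
change (Re (Cminus (u l) (x, y))) with (Re (u l) - x) in h5.
change (Im (Cminus (u l) (x, y))) with (Im (u l) - y) in h5.
assert (0 < (/ 2) ^ l) by (apply pow_lt; lra).
nra.
Qed.

Lemma continuous_circle_uniform_limit f :
  (forall eps, 0 < eps -> exists g, continuous_circle g /\
     forall t, Cmod (Cminus (g t) (f t)) <= eps) -> continuous_circle f.
Proof.
intros H; split; intros t.
- apply Cmod_minus_eq0, le_epsilon; intros eps heps; rewrite Rplus_0_l.
  destruct (H (eps / 2)) as (g & [pg _] & hg); [lra|].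
  eapply Rle_trans; [apply (Cmod_minus_triangle _ (g t))|].
  rewrite Cmod_minus_sym, <- (pg t) at 1.
  generalize (hg t) (hg (t + 2 * PI)); lra.
- apply (filterlim_locally_ball_norm (K := C_AbsRing) (U := C_NormedModule)).
  intros eps.
  destruct (H (eps / 3)) as (g & [_ cg] & hg); [generalize (cond_pos eps); lra|].
  assert (h := proj1 (filterlim_locally_ball_norm (K := C_AbsRing)
    (U := C_NormedModule) g (g t)) (cg t) (mkposreal (eps / 3)
      ltac:(generalize (cond_pos eps); lra))).
  revert h; apply filter_imp; intros s; rewrite !ball_norm_C; simpl; intros hs.
  eapply Rle_lt_trans; [apply (Cmod_minus_triangle _ (g s))|].
  eapply Rle_lt_trans; [apply Rplus_le_compat_l, (Cmod_minus_triangle _ (g t))|].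
  rewrite (Cmod_minus_sym (f s)).
  generalize (hg t) (hg s); lra.
Qed.

Lemma c0_norm_ub (a : c0) n : Cmod (proj1_sig a n) <= norm a.
Proof. apply (sup_norm_ub (proj1_sig a)), null_seq_bounded, (proj2_sig a). Qed.

Lemma c0_norm_le (a : c0) M : (forall n, Cmod (proj1_sig a n) <= M) -> norm a <= M.
Proof. apply (sup_norm_le O). Qed.

Lemma c0_minus_coord (a b : c0) n :
  proj1_sig (minus a b) n = Cminus (proj1_sig a n) (proj1_sig b n).
Proof. simpl; ring. Qed.

(** The coordinatewise limits are approached at a rate independent of the coordinate, so the limit
    sequence is a uniform limit of null sequences, hence null. *)
Lemma c0_limit_of_geometric_cauchy (x : nat -> c0) c :
  (forall k l, norm (minus (x k) (x l)) <= c * ((/ 2) ^ k + (/ 2) ^ l)) ->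
  exists a : c0, forall k, norm (minus (x k) a) <= c * (/ 2) ^ k.
Proof.
intros H.
assert (hc : 0 <= c)
  by (generalize (H O O) (norm_ge_0 (minus (x O) (x O))); simpl; lra).
assert (P : forall n, exists l, forall k,
  Cmod (Cminus (proj1_sig (x k) n) l) <= c * (/ 2) ^ k).
{ intros n; apply C_limit_of_geometric_cauchy; intros k l.
  rewrite <- c0_minus_coord; eapply Rle_trans; [apply c0_norm_ub|apply H]. }
set (a := fun n => proj1_sig (constructive_indefinite_description _ (P n))).
assert (Ha : forall n k, Cmod (Cminus (proj1_sig (x k) n) (a n)) <= c * (/ 2) ^ k)
  by (intros n; exact (proj2_sig (constructive_indefinite_description _ (P n)))).
assert (na : null_seq a).
{ apply null_seq_iff; intros eps heps.
  destruct (half_pow_lt (eps / 2 / (c + 1))) as [k hk].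
  { apply Rdiv_lt_0_compat; lra. }
  specialize (hk k (le_n k)); apply Rlt_div_r in hk; [|lra].
  destruct (proj1 (null_seq_iff _) (proj2_sig (x k)) (eps / 2)) as [K HK]; [lra|].
  exists K; intros n hn; specialize (HK n hn); specialize (Ha n k).
  replace (a n) with (Cminus (proj1_sig (x k) n) (Cminus (proj1_sig (x k) n) (a n)))
    by ring.
  eapply Rle_lt_trans; [apply Cmod_minus_le|].
  assert (0 < (/ 2) ^ k) by (apply pow_lt; lra).
  lra. }
exists (exist _ a na : c0); intros k; apply c0_norm_le; intros n.
rewrite c0_minus_coord; apply Ha.
Qed.

Lemma norm_minus_le0 {X : NormedModule C_AbsRing} (x y : X) :
  norm (minus x y) <= 0 -> x = y.
Proof.
intros H; apply (plus_reg_r (opp y)); rewrite plus_opp_r.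
apply norm_eq_zero, Rle_antisym; [exact H|apply norm_ge_0].
Qed.

(** The lower bound gives injectivity and a bounded inverse on the range. It also makes preimages of
    a convergent sequence Cauchy; by completeness of [c0] and continuity of [T], the limit is
    attained and the range is closed. *)
Lemma contains_c0_of_embedding (X : NormedModule C_AbsRing) (T : c0 -> X) m :
  is_linear T -> (forall a, norm a <= m * norm (T a)) -> contains_c0 X.
Proof.
intros hT hm.
assert (T0 : T zero = zero) by now apply linear_zero.
assert (Tminus : forall a b : c0, T (minus a b) = minus (T a) (T b)).
{ intros a b; unfold minus; rewrite (linear_plus _ hT); f_equal; now apply linear_opp. }
assert (hm' : forall a b : c0, norm (minus a b) <= m * norm (minus (T a) (T b)))
  by (intros a b; rewrite <- Tminus; apply hm).
assert (Tinj : forall a b, T a = T b -> a = b).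
{ intros a b E; apply norm_minus_le0.
  eapply Rle_trans; [apply hm'|]; rewrite E, minus_eq_zero.
  apply Req_le; rewrite <- (Rmult_0_r m); f_equal; apply @norm_zero. }
destruct (linear_norm _ hT) as [M [hM HM]].
exists (fun y => exists a, T a = y); split; [|split].
- split; [now exists zero|split].
  + intros x y [a <-] [b <-]; exists (plus a b); apply (linear_plus _ hT).
  + intros c x [a <-]; exists (scal c a); apply (linear_scal _ hT).
- intros y hy.
  (* [closed] only provides that no neighbourhood of [y] misses the range; excluded middle turns
     this into approximants. *)
  assert (P : forall k : nat, exists a, norm (minus (T a) y) < (/ 2) ^ k).
  { intros k; apply NNPP; intros Hk; apply hy.
    assert (he : 0 < (/ 2) ^ k) by (apply pow_lt; lra).
    apply (locally_le_locally_norm y); exists (mkposreal _ he).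
    intros z hz [a Ea]; apply Hk; exists a; rewrite Ea; exact hz. }
  set (x := fun k => proj1_sig (constructive_indefinite_description _ (P k))).
  assert (hx : forall k, norm (minus (T (x k)) y) < (/ 2) ^ k)
    by (intros k; exact (proj2_sig (constructive_indefinite_description _ (P k)))).
  (* The sign of [m] is not given, so the rate is taken with [Rabs m]. *)
  assert (m0 : 0 <= Rabs m) by apply Rabs_pos.
  destruct (c0_limit_of_geometric_cauchy x (Rabs m)) as [a Ha].
  { intros k l; eapply Rle_trans; [apply hm'|].
    apply Rle_trans with (Rabs m * norm (minus (T (x k)) (T (x l)))).
    - apply Rmult_le_compat_r; [apply norm_ge_0|apply Rle_abs].
    - apply Rmult_le_compat_l; [exact m0|].
      rewrite (minus_trans y).
      eapply Rle_trans; [apply norm_triangle|].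
      rewrite <- (norm_opp (minus y (T (x l)))), opp_minus.
      generalize (hx k) (hx l); lra. }
  exists a; apply norm_minus_le0.
  apply le_half_pow_0 with (M * Rabs m + 1); intros k.
  rewrite (minus_trans (T (x k))).
  eapply Rle_trans; [apply norm_triangle|].
  rewrite <- (norm_opp (minus (T a) (T (x k)))), opp_minus, <- Tminus.
  specialize (HM (minus (x k) a)).
  assert (M * norm (minus (x k) a) <= M * (Rabs m * (/ 2) ^ k))
    by (apply Rmult_le_compat_l; [lra|apply Ha]).
  generalize (hx k); lra.
(* The chosen preimage is arbitrary off the range; on the range injectivity makes it unique. *)
- exists T, (fun y => epsilon (inhabits zero) (fun a => T a = y)).
  assert (hS : forall y, (exists a, T a = y) ->
    T (epsilon (inhabits zero) (fun a => T a = y)) = y)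
    by (intros y; exact (epsilon_spec (inhabits zero) (fun a => T a = y))).
  split; [exact hT|split; [|split; [|split]]].
  + intros a; now exists a.
  + intros a; apply Tinj, hS; now exists a.
  + exact hS.
  + exists m; intros y hy.
    assert (H := hm (epsilon (inhabits zero) (fun a => T a = y))).
    rewrite (hS y hy) in H; exact H.
Qed.

(** * The series of blocks *)

Section HumpSeries.
Context (Lambda : Z -> Prop) (N : nat -> nat) (h : nat -> R -> C).
Context (N0 : N O = 1%nat)
  (hblock : forall n, block Lambda (N n) (N (S n)) ((/ 2) ^ n) (h n)).

Fixpoint hump_sum (a : nat -> C) (m : nat) (t : R) : C :=
  match m with
  | O => RtoC 0
  | S m => Cplus (hump_sum a m t) (Cmult (a m) (h m t))
  end.

Lemma N_mono m n : (m <= n)%nat -> (N m <= N n)%nat.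
Proof.
intros H; induction H as [|n H IH]; [lia|].
generalize (block_lt _ _ _ _ _ (hblock n)); lia.
Qed.

Lemma N_gt n : (n < N n)%nat.
Proof.
induction n as [|n IH]; [lia|].
generalize (block_lt _ _ _ _ _ (hblock n)); lia.
Qed.

Lemma N_interval k : (1 <= k)%nat -> exists m, (N m <= k < N (S m))%nat.
Proof.
intros hk; assert (H : forall n, (k < N n)%nat -> exists m, (N m <= k < N (S m))%nat).
{ induction n as [|n IH]; intros H; [lia|].
  destruct (le_lt_dec (N n) k); [now exists n|auto]. }
apply (H k), N_gt.
Qed.

Lemma continuous_circle_block n : continuous_circle (h n).
Proof. apply (block_deg _ _ _ _ _ (hblock n)). Qed.

Lemma hump_sum_deg a m : trig_poly_deg (N m) (hump_sum a m).
Proof.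
induction m as [|m IH]; [apply trig_poly_deg_0|].
apply trig_poly_deg_plus.
- eapply trig_poly_deg_weaken; [exact IH|apply N_mono; lia].
- apply trig_poly_deg_scal, (block_deg _ _ _ _ _ (hblock m)).
Qed.

Lemma hump_sum_continuous a m : continuous_circle (hump_sum a m).
Proof. apply (hump_sum_deg a m). Qed.

Lemma hump_sum_S_coef a m j :
  fourier_coef (hump_sum a (S m)) j =
  Cplus (fourier_coef (hump_sum a m) j) (Cmult (a m) (fourier_coef (h m) j)).
Proof.
rewrite <- fourier_coef_scal by apply continuous_circle_block.
apply fourier_coef_plus; [apply hump_sum_continuous|].
apply continuous_circle_scal, continuous_circle_block.
Qed.

Lemma hump_sum_spectrum a m : spectrum_in Lambda (hump_sum a m).
Proof.
intros j hj; induction m as [|m IH]; [apply fourier_coef_0|].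
rewrite hump_sum_S_coef, IH, (block_spectrum _ _ _ _ _ (hblock m) j hj); ring.
Qed.

Lemma hump_sum_coef_stable a m n j : (m <= n)%nat ->
  (Z.abs j <= Z.of_nat (N m))%Z ->
  fourier_coef (hump_sum a n) j = fourier_coef (hump_sum a m) j.
Proof.
intros H hj; induction H as [|n H IH]; [reflexivity|].
rewrite hump_sum_S_coef, IH, (block_low _ _ _ _ _ (hblock n)); [ring|].
generalize (N_mono _ _ H); lia.
Qed.

(** The right side is exactly the geometric sum of [sup_norm a * 2^-i] for [m <= i < n]; keeping it
    as a difference lets the induction close. *)
Lemma hump_sum_diff_le a m n t : bounded_fun a -> (m <= n)%nat ->
  Cmod (Cminus (hump_sum a n t) (hump_sum a m t))
  <= 2 * sup_norm a * ((/ 2) ^ m - (/ 2) ^ n).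
Proof.
intros ha H; induction H as [|n H IH].
- replace (Cminus _ _) with (RtoC 0) by ring; rewrite Cmod_0; lra.
- eapply Rle_trans; [apply (Cmod_minus_triangle _ (hump_sum a n t))|].
  simpl hump_sum.
  replace (Cminus (Cplus (hump_sum a n t) (Cmult (a n) (h n t))) (hump_sum a n t))
    with (Cmult (a n) (h n t)) by ring.
  rewrite Cmod_mult.
  assert (Cmod (a n) * Cmod (h n t) <= sup_norm a * (/ 2) ^ n).
  { apply Rmult_le_compat; try apply Cmod_ge_0; [now apply sup_norm_ub|].
    apply (block_small _ _ _ _ _ (hblock n)). }
  simpl; lra.
Qed.

(** The sum of the series, chosen together with a rate that does not depend on [t]. The choice is
    meaningful for bounded [a], which every statement below ensures. *)
Definition hump (a : nat -> C) (t : R) : C :=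
  epsilon (inhabits (RtoC 0)) (fun l => forall m,
    Cmod (Cminus (hump_sum a m t) l) <= 2 * sup_norm a * (/ 2) ^ m).

Lemma hump_spec a m t : bounded_fun a ->
  Cmod (Cminus (hump_sum a m t) (hump a t)) <= 2 * sup_norm a * (/ 2) ^ m.
Proof.
intros ha; revert m; unfold hump; apply epsilon_spec.
apply C_limit_of_geometric_cauchy.
assert (h0 := sup_norm_ge0 O a ha).
assert (K : forall k l, (k <= l)%nat ->
  Cmod (Cminus (hump_sum a k t) (hump_sum a l t))
  <= 2 * sup_norm a * ((/ 2) ^ k + (/ 2) ^ l)).
{ intros k l H; rewrite Cmod_minus_sym.
  eapply Rle_trans; [now apply hump_sum_diff_le|].
  apply Rmult_le_compat_l; [lra|].
  generalize (pow_le (/ 2) l); lra. }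
intros k l; destruct (le_lt_dec k l) as [H|H]; [now apply K|].
rewrite Cmod_minus_sym, Rplus_comm; apply K; lia.
Qed.

(** The constant [c] is left free because the natural rates for sums and multiples of sequences
    differ from [2 * sup_norm a]. *)
Lemma hump_unique a t z c : bounded_fun a ->
  (forall m, Cmod (Cminus (hump_sum a m t) z) <= c * (/ 2) ^ m) -> hump a t = z.
Proof.
intros ha H; apply Cmod_minus_eq0.
apply le_half_pow_0 with (2 * sup_norm a + c); intros m.
eapply Rle_trans; [apply (Cmod_minus_triangle _ (hump_sum a m t))|].
rewrite Cmod_minus_sym; generalize (H m) (hump_spec a m t ha); lra.
Qed.

Lemma hump_plus a b t : bounded_fun a -> bounded_fun b ->
  hump (fun n => Cplus (a n) (b n)) t = Cplus (hump a t) (hump b t).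
Proof.
intros ha hb.
apply hump_unique with (2 * sup_norm a + 2 * sup_norm b); [now apply bounded_plus|].
intros m.
assert (E : hump_sum (fun n => Cplus (a n) (b n)) m t =
  Cplus (hump_sum a m t) (hump_sum b m t)).
{ induction m as [|m IH]; simpl; [ring|rewrite IH; ring]. }
rewrite E.
replace (Cminus _ _) with (Cplus (Cminus (hump_sum a m t) (hump a t))
  (Cminus (hump_sum b m t) (hump b t))) by ring.
eapply Rle_trans; [apply Cmod_triangle|].
generalize (hump_spec a m t ha) (hump_spec b m t hb); lra.
Qed.

Lemma hump_scal c a t : bounded_fun a ->
  hump (fun n => Cmult c (a n)) t = Cmult c (hump a t).
Proof.
intros ha.
apply hump_unique with (Cmod c * (2 * sup_norm a)); [now apply bounded_scal|].
intros m.
assert (E : hump_sum (fun n => Cmult c (a n)) m t = Cmult c (hump_sum a m t)).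
{ induction m as [|m IH]; simpl; [ring|rewrite IH; ring]. }
rewrite E.
replace (Cminus _ _) with (Cmult c (Cminus (hump_sum a m t) (hump a t))) by ring.
rewrite Cmod_mult, Rmult_assoc.
apply Rmult_le_compat_l; [apply Cmod_ge_0|now apply hump_spec].
Qed.

Lemma hump_continuous a : bounded_fun a -> continuous_circle (hump a).
Proof.
intros ha; apply continuous_circle_uniform_limit; intros eps heps.
assert (h0 := sup_norm_ge0 O a ha).
destruct (half_pow_lt (eps / (2 * sup_norm a + 1))) as [m hm];
  [apply Rdiv_lt_0_compat; lra|].
specialize (hm m (le_n m)); apply Rlt_div_r in hm; [|lra].
exists (hump_sum a m); split; [apply hump_sum_continuous|intros t].
eapply Rle_trans; [now apply hump_spec|].
generalize (pow_le (/ 2) m); lra.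
Qed.

(** The [j]-th coefficient of the finite sums no longer changes from stage [m] on, and coefficients
    are continuous for the sup norm. Passing to stage [max m n] therefore bounds the discrepancy by
    the error of stage [n]. *)
Lemma hump_coef a m j : bounded_fun a -> (Z.abs j <= Z.of_nat (N m))%Z ->
  fourier_coef (hump a) j = fourier_coef (hump_sum a m) j.
Proof.
intros ha hj; symmetry; apply Cmod_minus_eq0.
apply le_half_pow_0 with (4 * sup_norm a); intros n.
assert (h0 := sup_norm_ge0 O a ha).
rewrite <- (hump_sum_coef_stable a m (max m n)) by (exact hj || lia).
rewrite <- fourier_coef_minus
  by (apply hump_sum_continuous || now apply hump_continuous).
eapply Rle_trans; [apply fourier_coef_bound|].
- apply continuous_circle_minus;
    [apply hump_sum_continuous|now apply hump_continuous].
- intros t; now apply hump_spec.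
- generalize (half_pow_anti n (max m n) ltac:(lia)); nra.
Qed.

Lemma hump_spectrum a : bounded_fun a -> spectrum_in Lambda (hump a).
Proof.
intros ha j hj; rewrite (hump_coef a (Z.to_nat (Z.abs j))).
- now apply hump_sum_spectrum.
- exact ha.
- generalize (N_gt (Z.to_nat (Z.abs j))); lia.
Qed.

(** Blocks before [m] have degree at most [N m <= k] and are complete; blocks after [m] only have
    frequencies above [N (S m) >= k]. Only block [m] is cut. Both endpoints are allowed, as the
    lower norm bound uses each of them. *)
Lemma hump_partial_sum a m k t : bounded_fun a -> (N m <= k <= N (S m))%nat ->
  partial_sum k (hump a) t =
  Cplus (hump_sum a m t) (Cmult (a m) (partial_sum k (h m) t)).
Proof.
intros ha hk.
rewrite (partial_sum_coef_ext k _ (hump_sum a (S m)))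
  by (intros j hj; apply hump_coef; [exact ha|lia]).
simpl hump_sum; rewrite partial_sum_plus, partial_sum_scal,
  (trig_poly_deg_partial_sum (N m));
  auto using hump_sum_deg, hump_sum_continuous, continuous_circle_scal,
    continuous_circle_block.
apply hk.
Qed.

(** Besides the uniformly small tail, the error contains the cut block, of modulus at most
    [Cmod (a m)]: this is where [a] must tend to zero. *)
Lemma hump_in_U a : null_seq a -> in_U (hump a).
Proof.
intros na; assert (ha := null_seq_bounded a na).
assert (h0 := sup_norm_ge0 O a ha).
apply in_U_uniform; [now apply hump_continuous|intros eps heps].
destruct (half_pow_lt (eps / 2 / (2 * sup_norm a + 1))) as [K1 h1];
  [apply Rdiv_lt_0_compat; lra|].
destruct (proj1 (null_seq_iff a) na (eps / 2)) as [K2 h2]; [lra|].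
exists (N (max K1 K2)); intros k t hk.
destruct (N_interval k) as [m hm]; [generalize (N_gt (max K1 K2)); lia|].
assert (hmK : (max K1 K2 <= m)%nat).
{ apply Nat.nlt_ge; intros hlt; generalize (N_mono (S m) (max K1 K2)); lia. }
rewrite (hump_partial_sum a m) by (exact ha || lia).
replace (Cminus _ _) with (Cplus (Cminus (hump_sum a m t) (hump a t))
  (Cmult (a m) (partial_sum k (h m) t))) by ring.
eapply Rle_trans; [apply Cmod_triangle|]; rewrite Cmod_mult.
specialize (h1 m ltac:(lia)); apply Rlt_div_r in h1; [|lra].
specialize (h2 m ltac:(lia)).
assert (h3 := hump_spec a m t ha).
assert (Cmod (a m) * Cmod (partial_sum k (h m) t) <= Cmod (a m) * 1).
{ apply Rmult_le_compat_l; [apply Cmod_ge_0|].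
  apply (block_partial_le _ _ _ _ _ (hblock m)). }
generalize (pow_le (/ 2) m); lra.
Qed.

(** The complete blocks add up to at most [2 * sup_norm a], and the cut one contributes at most
    [sup_norm a]. *)
Lemma hump_U_norm_le a : null_seq a -> U_norm (hump a) <= 3 * sup_norm a.
Proof.
intros na; assert (ha := null_seq_bounded a na).
assert (h0 := sup_norm_ge0 O a ha).
apply U_norm_le; intros k hk; apply (sup_norm_le 0); intros t.
destruct (N_interval k hk) as [m hm].
rewrite (hump_partial_sum a m) by (exact ha || lia).
eapply Rle_trans; [apply Cmod_triangle|]; rewrite Cmod_mult.
assert (h1 := hump_sum_diff_le a O m t ha ltac:(lia)).
replace (Cminus _ _) with (hump_sum a m t) in h1 by (simpl; ring).
assert (Cmod (a m) * Cmod (partial_sum k (h m) t) <= sup_norm a * 1).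
{ apply Rmult_le_compat; try apply Cmod_ge_0; [now apply sup_norm_ub|].
  apply (block_partial_le _ _ _ _ _ (hblock m)). }
assert (0 <= (/ 2) ^ m) by (apply pow_le; lra).
simpl in h1; nra.
Qed.

(** Subtracting [S_(N m)] from [S_k] leaves [a m] times the partial sum of block [m]. Two partial
    sums and a factor above [1 / 2] give the constant 4. *)
Lemma hump_U_norm_ge a : null_seq a -> sup_norm a <= 4 * U_norm (hump a).
Proof.
intros na; assert (ha := null_seq_bounded a na).
apply (sup_norm_le O); intros m.
destruct (block_partial_large _ _ _ _ _ (hblock m)) as (k & t & hk).
assert (hN := block_lt _ _ _ _ _ (hblock m)).
assert (h1 : (1 <= N m)%nat) by (generalize (N_gt m); lia).
(* The large partial sum can be taken inside the band: above it the sum is already all of [h m], as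
   at [N (S m)], and below it the sum vanishes. *)
assert (hkm : exists k', (N m <= k' <= N (S m))%nat /\
  1 / 2 < Cmod (partial_sum k' (h m) t)).
{ destruct (le_lt_dec (N (S m)) k) as [h2|h2].
  - exists (N (S m)); split; [lia|].
    rewrite (trig_poly_deg_partial_sum (N (S m))) in * by
      (apply (block_deg _ _ _ _ _ (hblock m)) || lia).
    exact hk.
  - exists k; split; [|exact hk].
    destruct (le_lt_dec (N m) k) as [h3|h3]; [lia|exfalso].
    rewrite partial_sum_vanish, Cmod_0 in hk; [lra|].
    intros j hj; apply (block_low _ _ _ _ _ (hblock m)); lia. }
clear k hk; destruct hkm as (k & hk & hm).
assert (B : forall i, (1 <= i)%nat ->
  Cmod (partial_sum i (hump a) t) <= U_norm (hump a)).
{ intros i hi; eapply Rle_trans; [apply sup_norm_ub, partial_sum_bounded|].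
  apply U_norm_ub; [now apply hump_in_U|exact hi]. }
assert (E : Cmult (a m) (partial_sum k (h m) t) =
  Cminus (partial_sum k (hump a) t) (partial_sum (N m) (hump a) t)).
{ rewrite !(hump_partial_sum a m) by (exact ha || lia).
  rewrite (partial_sum_vanish (N m)) by apply (block_low _ _ _ _ _ (hblock m)).
  ring. }
assert (H : Cmod (a m) * Cmod (partial_sum k (h m) t) <= 2 * U_norm (hump a)).
{ rewrite <- Cmod_mult, E; eapply Rle_trans; [apply Cmod_minus_le|].
  generalize (B k ltac:(lia)) (B (N m) h1); lra. }
generalize (Cmod_ge_0 (a m)); nra.
Qed.

Definition hump_embedding (a : c0) : U_Lambda Lambda :=
  exist (in_U_Lambda Lambda) (hump (proj1_sig a))
    (conj (hump_in_U _ (proj2_sig a))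
       (hump_spectrum _ (null_seq_bounded _ (proj2_sig a)))).

Lemma hump_embedding_linear : is_linear hump_embedding.
Proof.
split.
- intros a b; apply (fs_eq (U_space Lambda)); intros t.
  apply hump_plus; apply null_seq_bounded, proj2_sig.
- intros c a; apply (fs_eq (U_space Lambda)); intros t.
  apply hump_scal, null_seq_bounded, proj2_sig.
- exists 3; split; [lra|intros a].
  exact (hump_U_norm_le _ (proj2_sig a)).
Qed.

Lemma hump_embedding_lower (a : c0) : norm a <= 4 * norm (hump_embedding a).
Proof. exact (hump_U_norm_ge _ (proj2_sig a)). Qed.

End HumpSeries.

Theorem theorem3p1 (Lambda : Z -> Prop) (hLambda : ~ UC_set Lambda) :
  contains_c0 (U_Lambda Lambda).
Proof.
destruct (block_sequence Lambda hLambda) as (N & h & N0 & hblock).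
apply (contains_c0_of_embedding _ (hump_embedding Lambda N h N0 hblock) 4).
- apply hump_embedding_linear.
- apply hump_embedding_lower.
Qed.
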